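(* Let $k$ be a constant. There is a computable function $f$ and an algorithm that, given an $n$-vertex DAG $\vec H$, decides whether $\mathrm{dtd}(\vec H)\le k$ in time $O(n^{f(k)})$.
   Context: For a DAG $\vec H$, a source is a vertex of in-degree $0$. A DAG elimination forest of a DAG $\vec H$ is defined recursively: if $\vec H$ is empty, it is the empty forest; if the underlying undirected graph of $\vec H$ is disconnected, it is the union of DAG elimination forests (trees) of its connected components; if the underlying graph is connected and $\vec H$ has exactly one source $s$, it is the single-node tree $s$; otherwise (connected, at least two sources) it is a tree whose root is an arbitrarily chosen source $s$ of $\vec H$ and whose subtrees are the trees of a DAG elimination forest of the DAG obtained from $\vec H$ by deleting $s$ and all vertices reachable from $s$. The depth of a rooted forest is the maximum number of nodes on a root-to-leaf path ($0$ for the empty forest). $\mathrm{dtd}(\vec H)$ is the minimum depth of a DAG elimination forest of $\vec H$. *)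

(* Defs.v *)
From mathcomp Require Import all_boot.
Set Implicit Arguments. Unset Strict Implicit. Unset Printing Implicit Defensive.

Definition acyclic (n : nat) (e : rel 'I_n) : Prop :=
  forall u v, e u v -> ~~ connect e v u.

Inductive vtree (V : Type) := VNode of V & seq (vtree V).

Fixpoint tdepth (V : Type) (t : vtree V) : nat :=
  match t with
  | VNode _ ts =>
    S ((fix fd (ts : seq (vtree V)) : nat :=
          match ts with
          | [::] => 0
          | t1 :: ts' => maxn (tdepth t1) (fd ts')
          end) ts)
  end.

Definition fdepth (V : Type) (F : seq (vtree V)) : nat :=
  foldr (fun t m => maxn (tdepth t) m) 0 F.

Section Elim.
Variables (n : nat) (e : rel 'I_n).

Definition und_edge (S : {set 'I_n}) : rel 'I_n :=
  fun u v => [&& u \in S, v \in S & e u v || e v u].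

Definition comp (S : {set 'I_n}) (v : 'I_n) : {set 'I_n} :=
  [set u in S | connect (und_edge S) v u].

Definition sources (S : {set 'I_n}) : {set 'I_n} :=
  [set s in S | [forall u in S, ~~ e u s]].

Definition reach (S : {set 'I_n}) (s : 'I_n) : {set 'I_n} :=
  [set u in S | connect (fun x y => [&& x \in S, y \in S & e x y]) s u].

(* is_forest S F : F is a DAG elimination forest of H[S];
   is_tree S T : T is the DAG elimination tree of the (connected) H[S]. *)
Inductive is_forest : {set 'I_n} -> seq (vtree 'I_n) -> Prop :=
| ef_empty : is_forest set0 [::]
| ef_comp : forall (S : {set 'I_n}) (v : 'I_n) T F,
    v \in S ->
    is_tree (comp S v) T ->
    is_forest (S :\: comp S v) F ->
    is_forest S (T :: F)
with is_tree : {set 'I_n} -> vtree 'I_n -> Prop :=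
| et_one_source : forall (S : {set 'I_n}) (s : 'I_n),
    sources S = [set s] ->
    is_tree S (VNode s [::])
| et_many : forall (S : {set 'I_n}) (s : 'I_n) F,
    s \in sources S ->
    1 < #|sources S| ->
    is_forest (S :\: reach S s) F ->
    is_tree S (VNode s F).

Definition dtd_le (k : nat) : Prop :=
  exists F, is_forest [set: 'I_n] F /\ fdepth F <= k.

End Elim.

Inductive instr :=
| INC of nat
| DEC of nat
| JZ of nat & nat
| LDI of nat & nat
| STI of nat & nat
| HALT.

Record config := Config { pc : nat; mem : nat -> nat }.

Definition upd (m : nat -> nat) (a x : nat) : nat -> nat :=
  fun b => if b == a then x else m b.

Definition step (P : seq instr) (c : config) : config :=
  let: Config p m := c in
  match nth HALT P p with
  | INC i => Config p.+1 (upd m i (m i).+1)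
  | DEC i => Config p.+1 (upd m i (m i).-1)
  | JZ i l => if m i == 0 then Config l m else Config p.+1 m
  | LDI i j => Config p.+1 (upd m i (m (m j)))
  | STI i j => Config p.+1 (upd m (m i) (m j))
  | HALT => c
  end.

Fixpoint exec (P : seq instr) (t : nat) (c : config) : config :=
  if t is t'.+1 then exec P t' (step P c) else c.

(* a program halts when pc points to HALT (or outside the program) *)
Definition halted (P : seq instr) (c : config) : bool :=
  if nth HALT P (pc c) is HALT then true else false.

Definition runs_within (P : seq instr) (m0 : nat -> nat) (T out : nat) : Prop :=
  exists t, t <= T /\ halted P (exec P t (Config 0 m0)) /\
            mem (exec P t (Config 0 m0)) 0 = out.

Definition ram_computable (f : nat -> nat) : Prop :=
  exists P : seq instr, forall x, exists T,
    runs_within P (fun a => if a == 0 then x else 0) T (f x).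

Definition enc_graph (n : nat) (e : rel 'I_n) : nat -> nat :=
  fun a => if a == 0 then n
           else [exists i : 'I_n, exists j : 'I_n, (a == 1 + i * n + j) && e i j] : nat.

Definition decides_within (P : seq instr) (m0 : nat -> nat) (T : nat) (Q : Prop) : Prop :=
  exists out, runs_within P m0 T out /\ out <= 1 /\ (out = 1 <-> Q).

(* Main.v *)
Require Import Defs.
From Stdlib Require Import FunctionalExtensionality.
From mathcomp Require Import all_boot zify.
Set Implicit Arguments. Unset Strict Implicit. Unset Printing Implicit Defensive.

(** The predicate dtd <= k satisfies dtd_0(S) iff S is empty, and dtd_(k+1)(S) iff
    every v in S has a source s of its component C with dtd_k(C \ reach(s)).
    Unfolding this k times gives a formula of first-order logic with transitive
    closure whose nesting depth is linear in k, the successive vertex sets being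
    substituted as formulas. Evaluating such a formula by nested loops over the
    vertices takes time n^O(depth) on a random access machine; a transitive
    closure is computed by n rounds of relaxation in an array. *)

(** * Structured programs with a time-aware weakest precondition *)

(** The machine shapes the proof in two ways. Its arithmetic is successor and predecessor only, so
    an address of size about n^2 is computed by counting; one access to an edge or an array then
    costs O(n^2), which is the 2 beyond the nesting depth in the exponent. Its input starts at
    address 1 and so lies where the working registers are: those bits must be rescued before the
    registers are used, except cell 1, the diagonal entry (0,0), which acyclicity makes zero. Each
    unfolding nests two quantifiers and two closures, because reachability is taken inside a
    component that is itself defined by a closure. A quantifier costs a factor n+1 and a closure
    (n+1)^3, hence 8 per unfolding; the final emptiness test is one more quantifier, and the
    exponent becomes 8k + 3. Acyclicity also makes a unique source reach every vertex, so the
    single-node case of the definition needs no clause of its own in the recursion. *)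

Inductive lcmd :=
| Linc of nat
| Ldec of nat
| Lldi of nat & nat
| Lsti of nat & nat
| Lskip
| Lseq of lcmd & lcmd
| Lif of nat & lcmd & lcmd
| Lwhile of nat & lcmd.

Notation "c1 ;; c2" := (Lseq c1 c2) (at level 61, right associativity).

Fixpoint len (c : lcmd) : nat :=
  match c with
  | Lskip => 0
  | c1 ;; c2 => len c1 + len c2
  | Lif _ c1 c2 => (len c1 + len c2).+2
  | Lwhile _ c => (len c).+2
  | _ => 1
  end.

(* Register 1 is kept at 0 throughout, which makes [JZ 1 l] an unconditional jump. *)
Fixpoint gen (off : nat) (c : lcmd) : seq instr :=
  match c with
  | Linc x => [:: INC x]
  | Ldec x => [:: DEC x]
  | Lldi x y => [:: LDI x y]
  | Lsti x y => [:: STI x y]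
  | Lskip => [::]
  | c1 ;; c2 => gen off c1 ++ gen (off + len c1) c2
  | Lif x c1 c2 =>
      JZ x (off + (len c1).+2) :: gen off.+1 c1 ++
      JZ 1 (off + (len c1 + len c2).+2) :: gen (off + (len c1).+2) c2
  | Lwhile x c => JZ x (off + (len c).+2) :: rcons (gen off.+1 c) (JZ 1 off)
  end.

Lemma size_gen c off : size (gen off c) = len c.
Proof.
elim: c off => //= [c1 IH1 c2 IH2|x c1 IH1 c2 IH2|x c IH] off.
- by rewrite size_cat IH1 IH2.
- by rewrite size_cat /= IH1 IH2 addnS.
- by rewrite size_rcons IH.
Qed.

Definition code_at (P : seq instr) (off : nat) (l : seq instr) : Prop :=
  forall i, i < size l -> nth HALT P (off + i) = nth HALT l i.

Lemma code_at_cat P off l1 l2 :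
  code_at P off (l1 ++ l2) -> code_at P off l1 /\ code_at P (off + size l1) l2.
Proof.
move=> H; split=> i Hi.
  by rewrite H ?size_cat ?ltn_addr // nth_cat Hi.
by rewrite -addnA H ?size_cat ?ltn_add2l // nth_cat ltnNge leq_addr addKn.
Qed.

Lemma code_at_cons P off a l :
  code_at P off (a :: l) -> nth HALT P off = a /\ code_at P off.+1 l.
Proof.
move=> H; split; first by have := H 0 isT; rewrite addn0.
by move=> i Hi; have := H i.+1 Hi; rewrite addnS addSn.
Qed.

Lemma exec_add P t1 t2 c : exec P (t1 + t2) c = exec P t2 (exec P t1 c).
Proof. by elim: t1 c => //= t1 IH c; rewrite IH. Qed.

(** [t] and [m'] are chosen before the program [P] and the offset [off], so a fragment behaves alike
    wherever it is placed. The zero in register 1 is both assumed and restored, as the jumps rely on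
    it. *)
Definition wp (c : lcmd) (T : nat) (Q : (nat -> nat) -> Prop) (m : nat -> nat) :=
  m 1 = 0 -> exists t m', [/\ t <= T, m' 1 = 0, Q m' &
    forall P off, code_at P off (gen off c) ->
      exec P t (Config off m) = Config (off + len c) m'].

Lemma wp_mono c T T' (Q Q' : _ -> Prop) m :
  wp c T Q m -> T <= T' -> (forall m', m' 1 = 0 -> Q m' -> Q' m') -> wp c T' Q' m.
Proof.
move=> H le_T QQ' m1; have [t [m' [le_t m'1 Qm' He]]] := H m1.
exists t, m'; split=> //; [exact: leq_trans le_T | exact: QQ'].
Qed.

Lemma wp_skip (Q : _ -> Prop) m : Q m -> wp Lskip 0 Q m.
Proof. by move=> Qm m1; exists 0, m; split=> // P off _; rewrite addn0. Qed.

Lemma wp_step1 c m m' (Q : _ -> Prop) : len c = 1 ->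
  (m 1 = 0 -> m' 1 = 0) -> Q m' ->
  (forall P off, code_at P off (gen off c) ->
     step P (Config off m) = Config off.+1 m') ->
  wp c 1 Q m.
Proof.
move=> l1 H1 Qm' He m1; exists 1, m'; split=> //; first exact: H1.
by move=> P off /He /= ->; rewrite l1 addn1.
Qed.

Lemma wp_inc x (Q : _ -> Prop) m : x != 1 -> Q (upd m x (m x).+1) -> wp (Linc x) 1 Q m.
Proof.
move=> x1 Qm; apply: wp_step1 Qm _ => //; first by rewrite /upd eq_sym (negbTE x1).
by move=> P off /code_at_cons [/= -> _].
Qed.

Lemma wp_dec x (Q : _ -> Prop) m : Q (upd m x (m x).-1) -> wp (Ldec x) 1 Q m.
Proof.
move=> Qm; apply: wp_step1 Qm _ => //.
  by rewrite /upd; case: eqP => // <- ->.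
by move=> P off /code_at_cons [/= -> _].
Qed.

Lemma wp_ldi x y (Q : _ -> Prop) m : x != 1 -> Q (upd m x (m (m y))) -> wp (Lldi x y) 1 Q m.
Proof.
move=> x1 Qm; apply: wp_step1 Qm _ => //; first by rewrite /upd eq_sym (negbTE x1).
by move=> P off /code_at_cons [/= -> _].
Qed.

Lemma wp_sti x y (Q : _ -> Prop) m : m x != 1 -> Q (upd m (m x) (m y)) -> wp (Lsti x y) 1 Q m.
Proof.
move=> x1 Qm; apply: wp_step1 Qm _ => //; first by rewrite /upd eq_sym (negbTE x1).
by move=> P off /code_at_cons [/= -> _].
Qed.

Lemma wp_seq c1 c2 T1 T2 Q m :
  wp c1 T1 (wp c2 T2 Q) m -> wp (c1 ;; c2) (T1 + T2) Q m.
Proof.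
move=> H m1; have [t1 [m' [le1 m'1 H2 E1]]] := H m1.
have [t2 [m'' [le2 m''1 Qm E2]]] := H2 m'1.
exists (t1 + t2), m''; split=> //; first exact: leq_add.
move=> P off /code_at_cat; rewrite size_gen => -[C1 C2].
by rewrite exec_add E1 // E2 // addnA.
Qed.

Lemma wp_if x c1 c2 T Q m :
  (m x != 0 -> wp c1 T Q m) -> (m x = 0 -> wp c2 T Q m) ->
  wp (Lif x c1 c2) (T + 2) Q m.
Proof.
move=> H1 H2 m1; have [mx|mx] := eqVneq (m x) 0.
  have [t [m' [le m'1 Qm E]]] := H2 mx m1.
  exists t.+1, m'; split=> //; first by lia.
  move=> P off /code_at_cons [C0 /code_at_cat]; rewrite size_gen.
  move=> [_ /code_at_cons [_ C2]] /=; rewrite C0 mx eqxx E.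
    by congr Config; lia.
  by move: C2; congr (code_at P _ _); lia.
have [t [m' [le m'1 Qm E]]] := H1 mx m1.
exists (1 + (t + 1)), m'; split=> //; first by lia.
move=> P off /code_at_cons [C0 /code_at_cat]; rewrite size_gen.
move=> [C1 /code_at_cons [C2 _]]; rewrite !exec_add /= C0 (negbTE mx) E //=.
by rewrite C2 m'1 eqxx.
Qed.

(** The index of the invariant is the exact number of rounds left, so it yields termination and the
    time bound together; the 2 added to each round pays for the test and the jump back. *)
Lemma wp_while x c B (I : nat -> (nat -> nat) -> Prop) k m :
  (forall k m, I k.+1 m -> m x != 0) -> (forall m, I 0 m -> m x = 0) ->
  (forall k m, I k.+1 m -> wp c B (I k) m) ->
  I k m -> wp (Lwhile x c) (k * (B + 2) + 1) (I 0) m.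
Proof.
move=> Hn0 H0 Hc; elim: k m => [|k IH] m Im m1.
  exists 1, m; split=> // P off /code_at_cons [C0 _] /=.
  by rewrite C0 (H0 _ Im).
have [t [m' [le m'1 Im' E]]] := Hc _ _ Im m1.
have [t' [m'' [le' m''1 Im'' E']]] := IH _ Im' m'1.
exists (1 + (t + (1 + t'))), m''; split=> //; first by lia.
move=> P off CC; have /code_at_cons [C0] := CC.
rewrite -cats1 => /code_at_cat; rewrite size_gen => -[C1 /code_at_cons [C2 _]].
by rewrite !exec_add /= C0 (negbTE (Hn0 _ _ Im)) E //= C2 m'1 eqxx E'.
Qed.

Lemma updE m a x b : upd m a x b = if b == a then x else m b.
Proof. by []. Qed.

Ltac memext := apply: functional_extensionality => ?; rewrite /upd;
  repeat case: eqP => ?; subst; try lia; try congruence.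

(** The copies are unrolled into the code, so [k] must be a constant of the program and cannot
    depend on the input. *)
Definition rep (k : nat) (c : lcmd) : lcmd := iter k (Lseq c) Lskip.

Lemma wp_rep c B (I : nat -> (nat -> nat) -> Prop) k m :
  (forall i m, i < k -> I i m -> wp c B (I i.+1) m) -> I 0 m ->
  wp (rep k c) (k * B) (I k) m.
Proof.
elim: k I m => [|k IH] I m Hc I0; first exact: wp_skip.
rewrite mulSn; apply: wp_seq; apply: wp_mono (Hc 0 m isT I0) (leqnn _) _ => m' _ I1.
by apply: (IH (fun i => I i.+1)) I1 => i m2 lti; apply: Hc.
Qed.

Lemma wp_rep_inc x k (Q : _ -> Prop) m : x != 1 ->
  Q (upd m x (m x + k)) -> wp (rep k (Linc x)) k Q m.
Proof.
move=> x1 Qm; rewrite -{2}[k]muln1.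
apply: wp_mono (wp_rep (I := fun i m' => m' = upd m x (m x + i)) _ _) (leqnn _) _.
- by move=> i m' lti ->; apply: wp_inc => //; memext.
- by memext.
- by move=> m' _ ->.
Qed.

Lemma wp_rep_dec x k (Q : _ -> Prop) m :
  Q (upd m x (m x - k)) -> wp (rep k (Ldec x)) k Q m.
Proof.
move=> Qm; rewrite -{2}[k]muln1.
apply: wp_mono (wp_rep (I := fun i m' => m' = upd m x (m x - i)) _ _) (leqnn _) _.
- by move=> i m' lti ->; apply: wp_dec => //; memext.
- by memext.
- by move=> m' _ ->.
Qed.

Definition zero (x : nat) : lcmd := Lwhile x (Ldec x).

Lemma wp_zero x (Q : _ -> Prop) m : Q (upd m x 0) -> wp (zero x) (m x * 3 + 1) Q m.
Proof.
move=> Qm; apply: wp_mono (wp_while (I := fun k m' => m' = upd m x k) (B := 1) _ _ _ _) _ _ => //.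
- by move=> k m' ->; rewrite updE eqxx.
- by move=> m' ->; rewrite updE eqxx.
- by move=> k m' ->; apply: wp_dec => //; memext.
- by memext.
- by move=> m' _ ->.
Qed.

(* The register 5 is the scratch counter that restores [x]. *)
Definition addto (x y : nat) : lcmd :=
  Lwhile x (Ldec x ;; Linc y ;; Linc 5) ;; Lwhile 5 (Ldec 5 ;; Linc x).

Lemma wp_addto x y (Q : _ -> Prop) m :
  x != y -> x != 5 -> y != 5 -> x != 1 -> y != 1 -> m 5 = 0 ->
  Q (upd m y (m y + m x)) -> wp (addto x y) (m x * 9 + 2) Q m.
Proof.
move=> xy x5 y5 x1 y1 m5 Qm.
(* Per unit of [x], 5 steps move it into both [y] and register 5, and 4 steps bring it back from
   register 5. *)
apply: wp_mono (_ : m x * 5 + 1 + (m x * 4 + 1) <= _) _ => [|| m' _ H]; last exact: H.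
  apply: wp_seq.
  apply: wp_mono (wp_while (B := 3) (k := m x) (I := fun k m' => k <= m x /\ m' = upd (upd (upd m x k)
      y (m y + (m x - k))) 5 (m x - k)) _ _ _ _) (leqnn _) _ => //.
  - by move=> k m' [_ ->]; rewrite !updE eqxx (negbTE xy) (negbTE x5).
  - by move=> m' [_ ->]; rewrite !updE eqxx (negbTE xy) (negbTE x5).
  - move=> k m' [lek ->]; apply: (@wp_seq _ _ 1 2); apply: wp_dec.
    apply: (@wp_seq _ _ 1 1); apply: wp_inc => //; apply: wp_inc => //; split; first by lia.
    by memext.
  - by split=> //; memext.
  move=> m' _ [_ ->].
  apply: wp_mono (wp_while (B := 2) (k := m x) (I := fun k m' => k <= m x /\ m' = upd (upd (upd m x (m x - k))
      y (m y + m x)) 5 k) _ _ _ _) (leqnn _) _ => //.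
  - by move=> k m2 [_ ->].
  - by move=> m2 [_ ->].
  - move=> k m2 [lek ->]; apply: (@wp_seq _ _ 1 1); apply: wp_dec; apply: wp_inc => //.
    by split; [lia | memext].
  - by split=> //; memext.
  move=> m2 _ [_ ->]; suff -> : upd (upd (upd m x (m x - 0)) y (m y + m x)) 5 0 = upd m y (m y + m x) by [].
  by memext.
by lia.
Qed.

(* Empties the register [x]. *)
Definition muladd (x z y : nat) : lcmd := Lwhile x (Ldec x ;; addto z y).

Lemma wp_muladd x z y (Q : _ -> Prop) m :
  uniq [:: x; y; z; 5; 1] -> m 5 = 0 ->
  Q (upd (upd m x 0) y (m y + m x * m z)) -> wp (muladd x z y) (m x * (m z * 9 + 5) + 1) Q m.
Proof.
rewrite /= !inE !negb_or -!andbA => /and5P[xy xz x5 x1 /and5P[yz y5 y1 z5 /andP[z1 _]]] m5 Qm.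
apply: wp_mono (wp_while (B := 1 + (m z * 9 + 2)) (k := m x) (I := fun k m' => k <= m x /\ m' = upd (upd m x k)
      y (m y + (m x - k) * m z)) _ _ _ _) _ _ => //.
- by move=> k m' [_ ->]; rewrite !updE eqxx (negbTE xy).
- by move=> m' [_ ->]; rewrite !updE eqxx (negbTE xy).
- move=> k m' [lek ->]; apply: wp_seq; apply: wp_dec.
  match goal with |- wp _ _ _ ?m0 => set m2 := m0 end.
  have m2z : m2 z = m z.
    by rewrite /m2 !updE ![z == _]eq_sym (negbTE xz) (negbTE yz).
  rewrite -m2z; apply: wp_addto => //; rewrite ?(eq_sym z) //.
    by rewrite /m2 !updE ![5 == _]eq_sym (negbTE x5) (negbTE y5).
  split; first by lia.
  by rewrite m2z /m2; memext; nia.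
- by split=> //; memext.
- by lia.
- by move=> m' _ [_ ->]; rewrite subn0.
Qed.

(** * Memory access and loops *)

Ltac upds := rewrite /upd; repeat (case: eqP => ?); subst; try lia; try congruence.

Lemma wp_le c T T' Q m : wp c T Q m -> T <= T' -> wp c T' Q m.
Proof. by move=> H le_T; apply: wp_mono H le_T _. Qed.

(* Register 0 holds [n], 1 holds 0, 2 holds [base], 3 the latest truth value,
   4 an address; 5 and 6 are scratch. Each binding level [d] of a formula owns a
   loop index, a loop counter and a flag. *)
Definition idx (d : nat) := 7 + 3 * d.
Definition cnt (d : nat) := 8 + 3 * d.
Definition flg (d : nat) := 9 + 3 * d.
Definition nreg (D : nat) := 7 + 3 * D.
(** The input ends at address n*n, so everything from [base] on is free. The first [nreg D] cells
    there hold saved input bits; behind them comes one array of length [n] per binding level. *)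
Definition base (D n : nat) := n * n + nreg D.
Definition arr (D n d i : nat) := base D n + nreg D + d * n + i.
Ltac unregs := rewrite /arr /base /nreg /idx /cnt /flg.

(* The input cell [p] stays in place, unless a register occupies it, in which case
   it has been saved at [base + p]. *)
Definition edge_addr (D vx vy : nat) : lcmd :=
  addto vx 6 ;; muladd 6 0 4 ;; addto vy 4 ;; Linc 4 ;;
  addto 4 6 ;; rep (nreg D).-1 (Ldec 6) ;;
  Lif 6 Lskip (addto 2 4) ;; zero 6.

Lemma wp_edge_addr D n vx vy i j (Q : _ -> Prop) m :
  7 <= vx -> 7 <= vy -> i < n -> j < n ->
  m 0 = n -> m 2 = base D n -> m 4 = 0 -> m 5 = 0 -> m 6 = 0 -> m vx = i -> m vy = j ->
  (let p := 1 + i * n + j in Q (upd m 4 (if nreg D <= p then p else base D n + p))) ->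
  wp (edge_addr D vx vy) ((100 + 50 * nreg D) * n.+1 ^ 2) Q m.
Proof.
move=> hx hy ltin ltjn m0 m2 m4 m5 m6 mx my; set p := 1 + i * n + j => /= Qm.
have lep : p <= n * n by rewrite /p; nia.
apply: wp_le (_ : i * 9 + 2 + (i * (n * 9 + 5) + 1 + (j * 9 + 2 + (1 + (p * 9 + 2 + ((nreg D).-1
   + (base D n * 9 + 2 + 2 + (p * 3 + 1))))))) <= _); last by rewrite /base; nia.
have n1 : 1 != vx by lia.
rewrite -{1}mx; apply/wp_seq/wp_addto => //; try lia.
set m' := upd _ _ _.
have m'0 : m' 0 = n by rewrite /m'; upds.
have m'6 : m' 6 = i by rewrite /m'; upds.
rewrite -m'0 -m'6; apply/wp_seq/wp_muladd => //.
rewrite m'0 m'6.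
set m'' := upd _ _ _.
have -> : m'' = upd m 4 (i * n) by rewrite /m'' /m'; memext.
rewrite -my -[m vy](_ : upd m 4 (i * n) vy = _); last by upds.
apply/wp_seq/wp_addto => //; try lia.
apply/wp_seq/wp_inc => //.
rewrite -[upd (upd _ _ _) _ _](_ : upd m 4 p = _); last by rewrite /p; memext.
rewrite -{1}[p](_ : upd m 4 p 4 = _) //.
apply/wp_seq. apply/wp_addto => //.
(* Truncated subtraction does the comparison: register 6 ends up nonzero exactly when
   [nreg D <= p]. *)
apply/wp_seq/wp_rep_dec.
set m3 := upd (upd _ _ _) _ _.
have -> : m3 = upd (upd m 4 p) 6 (p - (nreg D).-1) by rewrite /m3; memext.
apply/wp_seq.
apply: wp_if; rewrite updE eqxx => Hp.
  apply: wp_le (wp_skip _) (leq0n _).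
  apply: wp_le (wp_zero _) _; last by rewrite updE eqxx; lia.
  suff -> : upd (upd (upd m 4 p) 6 (p - (nreg D).-1)) 6 0 =
           upd m 4 (if nreg D <= p then p else base D n + p) by [].
  have -> : nreg D <= p by move: Hp; rewrite /nreg; lia.
  by memext.
rewrite -m2 -[m 2](_ : upd (upd m 4 p) 6 (p - (nreg D).-1) 2 = _) //.
apply: wp_addto => //.
apply: wp_le (wp_zero _) _; last by upds.
match goal with |- Q ?mm => suff -> : mm = upd m 4 (if nreg D <= p then p else base D n + p) by [] end.
rewrite leqNgt (_ : p < nreg D); last by move: Hp; rewrite /nreg; lia.
by rewrite /=; memext.
Qed.

Definition edge_read D vx vy := edge_addr D vx vy ;; Lldi 3 4 ;; zero 4.

Lemma wp_edge_read D n vx vy i j (Q : _ -> Prop) m :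
  7 <= vx -> 7 <= vy -> i < n -> j < n ->
  m 0 = n -> m 2 = base D n -> m 4 = 0 -> m 5 = 0 -> m 6 = 0 -> m vx = i -> m vy = j ->
  (let p := 1 + i * n + j in Q (upd m 3 (m (if nreg D <= p then p else base D n + p)))) ->
  wp (edge_read D vx vy) ((120 + 60 * nreg D) * n.+1 ^ 2) Q m.
Proof.
move=> hx hy ltin ltjn m0 m2 m4 m5 m6 mx my /= Qm.
set p := 1 + i * n + j in Qm; set a := (if _ then _ else _) in Qm.
have lep : p <= n * n by rewrite /p; nia.
have lea : a <= base D n + n * n by rewrite /a; case: ifP; rewrite /base; lia.
have gta : 4 < a by rewrite /a /base /nreg; case: ifP; lia.
apply: wp_le (_ : (100 + 50 * nreg D) * n.+1 ^ 2 + (1 + (a * 3 + 1)) <= _); last by move: lea; rewrite /base; nia.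
apply/wp_seq/(wp_edge_addr hx hy ltin ltjn m0 m2 m4 m5 m6 mx my).
rewrite /= -/p -/a; apply/wp_seq/wp_ldi => //.
apply: wp_le (wp_zero _) _; last by [].
match goal with |- Q ?mm => suff -> : mm = upd m 3 (m a) by [] end.
by memext.
Qed.

Definition arr_addr D d v := addto 2 4 ;; addto v 4 ;; rep (nreg D) (Linc 4) ;; rep d (addto 0 4).

Lemma wp_arr_addr D n d v i (Q : _ -> Prop) m :
  7 <= v -> i < n -> d <= D -> m 0 = n -> m 2 = base D n -> m 4 = 0 -> m 5 = 0 -> m v = i ->
  Q (upd m 4 (arr D n d i)) ->
  wp (arr_addr D d v) ((100 + 50 * nreg D) * n.+1 ^ 2) Q m.
Proof.
move=> hv ltin led m0 m2 m4 m5 mv Qm.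
apply: wp_le (_ : base D n * 9 + 2 + (i * 9 + 2 + (nreg D + d * (n * 9 + 2))) <= _); last first.
  have : d * (n * 9 + 2) <= nreg D * (n * 9 + 2) by rewrite leq_mul // /nreg; lia.
  by rewrite /base; nia.
rewrite -{1}m2; apply/wp_seq/wp_addto => //.
rewrite -{1}mv -[m v](_ : upd m 4 (m 4 + m 2) v = _); last by upds.
apply/wp_seq/wp_addto => //; try lia.
apply/wp_seq/wp_rep_inc => //.
set m3 := upd _ _ _.
have -> : m3 = upd m 4 (base D n + i + nreg D) by rewrite /m3; memext.
apply: wp_mono (wp_rep (I := fun k m' => m' = upd m 4 (base D n + i + nreg D + k * n)) _ _) (leqnn _) _.
- move=> k m' ltk ->; rewrite -m0.
  rewrite -{1}[m 0](_ : upd m 4 (base D (m 0) + i + nreg D + k * m 0) 0 = _) //.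
  by apply: wp_addto => //; memext.
- by memext.
move=> m' _ ->; suff -> : base D n + i + nreg D + d * n = arr D n d i by [].
by rewrite /arr; lia.
Qed.

Definition arr_read D d v := arr_addr D d v ;; Lldi 3 4 ;; zero 4.
Definition arr_write D d v := arr_addr D d v ;; Lsti 4 3 ;; zero 4.

Lemma arr_cost D n d i : d <= D -> i < n ->
  arr D n d i * 3 + 2 <= (20 + 10 * nreg D) * n.+1 ^ 2.
Proof.
move=> led ltin; have : d * n <= nreg D * n by rewrite leq_mul // /nreg; lia.
by rewrite /arr /base; nia.
Qed.

Lemma wp_arr_read D n d v i (Q : _ -> Prop) m :
  7 <= v -> i < n -> d <= D -> m 0 = n -> m 2 = base D n -> m 4 = 0 -> m 5 = 0 -> m v = i ->
  Q (upd m 3 (m (arr D n d i))) ->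
  wp (arr_read D d v) ((120 + 60 * nreg D) * n.+1 ^ 2) Q m.
Proof.
move=> hv ltin led m0 m2 m4 m5 mv Qm.
have gta : 4 < arr D n d i by unregs; lia.
apply: wp_le (_ : (100 + 50 * nreg D) * n.+1 ^ 2 + (1 + (arr D n d i * 3 + 1)) <= _); last first.
  by have := arr_cost led ltin; nia.
apply/wp_seq/(wp_arr_addr hv ltin led m0 m2 m4 m5 mv).
apply/wp_seq/wp_ldi => //.
apply: wp_le (wp_zero _) _; last by [].
match goal with |- Q ?mm => suff -> : mm = upd m 3 (m (arr D n d i)) by [] end.
by memext.
Qed.

Lemma wp_arr_write D n d v i (Q : _ -> Prop) m :
  7 <= v -> i < n -> d <= D -> m 0 = n -> m 2 = base D n -> m 4 = 0 -> m 5 = 0 -> m v = i ->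
  Q (upd m (arr D n d i) (m 3)) ->
  wp (arr_write D d v) ((120 + 60 * nreg D) * n.+1 ^ 2) Q m.
Proof.
move=> hv ltin led m0 m2 m4 m5 mv Qm.
have gta : 4 < arr D n d i by unregs; lia.
apply: wp_le (_ : (100 + 50 * nreg D) * n.+1 ^ 2 + (1 + (arr D n d i * 3 + 1)) <= _); last first.
  by have := arr_cost led ltin; nia.
apply/wp_seq/(wp_arr_addr hv ltin led m0 m2 m4 m5 mv).
apply/wp_seq/wp_sti; first by rewrite updE eqxx; lia.
rewrite updE eqxx.
apply: wp_le (wp_zero _) _; last by rewrite !updE eqxx; case: eqP; lia.
match goal with |- Q ?mm => suff -> : mm = upd m (arr D n d i) (m 3) by [] end.
by memext.
Qed.

Definition for_ d body :=
  addto 0 (cnt d) ;; Lwhile (cnt d) (body ;; Linc (idx d) ;; Ldec (cnt d)) ;; zero (idx d).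

(** Loop invariants speak of the memory with the loop's own index and counter zeroed. They thus
    describe the state before and after the loop as well as between two rounds. *)
Definition clr d m := upd (upd m (idx d) 0) (cnt d) 0.

Lemma wp_for n d body B (J : nat -> (nat -> nat) -> Prop) m :
  m 0 = n -> m 5 = 0 -> m (idx d) = 0 -> m (cnt d) = 0 ->
  J 0 m ->
  (forall i m1, i < n -> m1 (idx d) = 0 -> m1 (cnt d) = 0 -> J i m1 ->
     wp body B (fun m2 => [/\ m2 (idx d) = i, m2 (cnt d) = n - i & J i.+1 (clr d m2)])
       (upd (upd m1 (idx d) i) (cnt d) (n - i))) ->
  wp (for_ d body) ((B + 20) * n.+1) (J n) m.
Proof.
move=> m0 m5 mi mc J0 Hb.
apply: wp_le (_ : n * 9 + 2 + (n * (B + 2 + 2) + 1 + (n * 3 + 1)) <= _); last by nia.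
rewrite -{1}m0; apply/wp_seq/wp_addto => //.
rewrite m0 mc add0n; apply: wp_seq.
apply: wp_mono (wp_while (B := B + 2) (k := n) (I := fun k m' => [/\ k <= n, m' (idx d) = n - k,
   m' (cnt d) = k & J (n - k) (clr d m')]) _ _ _ _) (leqnn _) _.
- by move=> k m' [_ _ -> _].
- by move=> m' [_ _ -> _].
- move=> k m' [lek mi' mc' Jm']; apply: wp_seq.
  have -> : m' = upd (upd (clr d m') (idx d) (n - k.+1)) (cnt d) (n - (n - k.+1)).
    by rewrite /clr; unregs; move: mi' mc'; unregs => mi' mc'; memext.
  apply: wp_mono (Hb (n - k.+1) (clr d m') _ _ _ Jm') (leqnn _) _.
  + lia.
  + by rewrite /clr; unregs; upds.
  + by rewrite /clr; upds.
  move=> m2 _ [m2i m2c J2]; apply: (@wp_seq _ _ 1 1); apply: wp_inc => //; apply: wp_dec.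
  have ne : (idx d == cnt d) = false by unregs; lia.
  split; first by lia.
  + by rewrite !updE ne eqxx m2i; lia.
  + by rewrite !updE eqxx eq_sym ne m2c; lia.
  have -> : n - k = (n - k.+1).+1 by lia.
  suff -> : clr d (upd (upd m2 (idx d) (m2 (idx d)).+1) (cnt d)
      (upd m2 (idx d) (m2 (idx d)).+1 (cnt d)).-1) = clr d m2 by [].
  by rewrite /clr; memext.
- split=> //; [by rewrite subnn updE; unregs; upds | by rewrite updE eqxx |].
  rewrite subnn; suff -> : clr d (upd m (cnt d) n) = m by [].
  by rewrite /clr; memext.
move=> m' _ [_ mi' mc']; rewrite subn0 => Jn.
apply: wp_le (wp_zero _) _; last by rewrite mi'; lia.
suff -> : upd m' (idx d) 0 = clr d m' by [].
by rewrite /clr; memext.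
Qed.

(** * A recursion for the DAG tree-depth *)

Scheme is_forest_mut := Induction for is_forest Sort Prop
with is_tree_mut := Induction for is_tree Sort Prop.

Section Dtd.
Variables (n : nat) (e : rel 'I_n).
Implicit Types (S : {set 'I_n}) (F : seq (vtree 'I_n)).

Lemma und_sym S : connect_sym (und_edge e S).
Proof. by apply: sym_connect_sym => x y; rewrite /und_edge andbCA orbC. Qed.

Lemma mem_comp S v : v \in S -> v \in Defs.comp e S v.
Proof. by move=> vS; rewrite inE vS connect0. Qed.

Lemma comp_eq S v w : w \in Defs.comp e S v -> Defs.comp e S w = Defs.comp e S v.
Proof.
rewrite inE => /andP[wS vw]; apply/setP => u; rewrite !inE; congr (_ && _).
exact/esym/(same_connect (und_sym S)).
Qed.

(** A walk in [S] that starts outside the component of [v] never enters it, since an entered vertex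
    would pull its predecessor into that component. Walks from [w] therefore survive the deletion,
    and components can be split off one by one. *)
Lemma comp_setD S v w : w \in S :\: Defs.comp e S v ->
  Defs.comp e (S :\: Defs.comp e S v) w = Defs.comp e S w.
Proof.
move=> wS'; have wS : w \in S by move: wS'; rewrite inE => /andP[].
apply/setP => u; apply/idP/idP.
  rewrite inE => /andP[/setDP[uS _] cwu]; rewrite inE uS.
  apply: connect_sub cwu => x y /and3P[/setDP[xS _] /setDP[yS _] exy].
  by rewrite connect1 // /und_edge xS yS.
rewrite inE => /andP[_ /connectP[p]].
elim: p w wS' {wS} => [|x p IH] w wS' /= => [_ ->|/andP[wx px] Eu]; first exact: mem_comp.
have /and3P[wS xS _] := wx.
have xS' : x \in S :\: Defs.comp e S v.
  rewrite inE xS andbT; apply: contraL wS' => xv; rewrite inE negb_and negbK wS orbF.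
  by rewrite -(comp_eq xv) inE wS und_sym connect1.
have := IH _ xS' px Eu; rewrite !inE => /andP[-> xu]; apply: connect_trans xu.
by apply: connect1; rewrite /und_edge wS' xS'; case/and3P: wx.
Qed.

(** Quantifying over the vertices of [S] examines a component once for each of its vertices, but it
    avoids any choice of a decomposition and so can be written in first-order form. *)
Fixpoint dt (k : nat) (S : {set 'I_n}) : bool :=
  if k is k'.+1 then
    [forall v in S, [exists s in sources e (Defs.comp e S v),
       dt k' (Defs.comp e S v :\: reach e (Defs.comp e S v) s)]]
  else S == set0.

Lemma dt_set0 k : dt k set0.
Proof. by case: k => [|k] /=; [exact: eqxx | apply/forall_inP => v; rewrite inE]. Qed.

Lemma dt_forest k S : dt k S -> exists F, is_forest e S F /\ fdepth F <= k.
Proof.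
elim: k S => [|k IHk] S; first by move=> /eqP ->; exists [::]; split=> //; constructor.
(* For a fixed depth, components are split off one at a time, by induction on the size of [S]. *)
have [m] := ubnP #|S|; elim: m S => // m IHm S ltm dtS.
have [->|[v vS]] := set_0Vmem S; first by exists [::]; split=> //; constructor.
have [T [treeT dT]] : exists T, is_tree e (Defs.comp e S v) T /\ tdepth T <= k.+1.
  move/forall_inP: (dtS) => /(_ v vS) /exists_inP[s ss].
  move=> /IHk [F [forF dF]].
  (* With a single source the definition prescribes a single node; the forest [F] is then discarded
     and the depth is 1. *)
  have [le1|gt1] := leqP #|sources e (Defs.comp e S v)| 1.
    exists (VNode s [::]); split=> //; apply: et_one_source.
    apply/esym/eqP; rewrite eqEcard sub1set ss cards1 //.
  by exists (VNode s F); split=> //; apply: et_many.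
have dtS' : dt k.+1 (S :\: Defs.comp e S v).
  apply/forall_inP => w wS'; rewrite (comp_setD wS').
  by move/forall_inP: dtS; apply; case/setDP: wS'.
have [|F [forF dF]] := IHm _ _ dtS'.
  rewrite -ltnS; apply: leq_ltn_trans ltm.
  rewrite -(cardsID (Defs.comp e S v) S) -[X in X < _]add0n ltn_add2r card_gt0.
  by apply/set0Pn; exists v; rewrite inE vS mem_comp.
exists (T :: F); split; first exact: ef_comp vS treeT forF.
by rewrite /fdepth /= geq_max dT.
Qed.

Definition sedge S : rel 'I_n := fun x y => [&& x \in S, y \in S & e x y].

(** Descent on the set of ancestors of [u] inside [S]: passing to an in-neighbour [w] shrinks it
    strictly, because [u] is an ancestor of itself but, by acyclicity, not of [w]. *)
Lemma source_above S u : acyclic e -> u \in S ->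
  exists2 s, s \in sources e S & connect (sedge S) s u.
Proof.
move=> ac; have [m] := ubnP #|[set x | connect (sedge S) x u]|.
elim: m u => // m IH u ltm uS.
have [us|] := boolP (u \in sources e S); first by exists u; rewrite ?connect0.
rewrite inE uS => /forall_inPn[w wS]; rewrite negbK => ewu.
have swu : sedge S w u by rewrite /sedge wS uS.
have [|s ss sw] := IH w _ wS; last by exists s; rewrite // (connect_trans sw) ?connect1.
rewrite -ltnS; apply: leq_ltn_trans ltm; apply: proper_card.
apply/properP; split.
  by apply/subsetP => x; rewrite !inE => xw; rewrite (connect_trans xw) ?connect1.
exists u; rewrite inE ?connect0 //; apply: contra (ac _ _ ewu) => uw.
by apply: connect_sub uw => x y /and3P[_ _ exy]; apply: connect1.
Qed.

(** The depth bound is quantified inside both induction predicates because it drops from a tree to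
    the forest below its root. Trees are measured against [k.+1] because none has depth 0. *)
Lemma forest_dt S F k : acyclic e -> is_forest e S F -> fdepth F <= k -> dt k S.
Proof.
move=> ac forF; pose PT S T (_ : is_tree e S T) := forall k, tdepth T <= k.+1 ->
  exists2 s, s \in sources e S & dt k (S :\: reach e S s).
pose PF S F (_ : is_forest e S F) := forall k, fdepth F <= k -> dt k S.
apply: (is_forest_mut (P := PF) (P0 := PT)) forF k; rewrite /PF /PT.
- by move=> k _; apply: dt_set0.
- move=> {}S v T {}F vS _ IHT _ IHF [|k]; rewrite /= geq_max => /andP[dT dF].
    by case: T {IHT} dT.
  apply/forall_inP => w wS; have [wv|wv] := boolP (w \in Defs.comp e S v).
    by rewrite (comp_eq wv); apply/exists_inP; apply: IHT.
  have wS' : w \in S :\: Defs.comp e S v by rewrite inE wv.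
  by have /forall_inP/(_ w wS') := IHF k.+1 dF; rewrite comp_setD.
- move=> {}S s Es k _; exists s; first by rewrite Es set11.
  (* The only source reaches all of [S], so nothing remains and the single-node rule satisfies the
     same condition as the general one. *)
  suff -> : S :\: reach e S s = set0 by apply: dt_set0.
  apply/eqP; rewrite setD_eq0; apply/subsetP => u uS; rewrite inE uS.
  by have [s'] := source_above ac uS; rewrite Es => /set1P ->.
- by move=> {}S s {}F sS _ _ IHF k dF; exists s => //; apply: IHF.
Qed.

Lemma dtP S k : acyclic e ->
  reflect (exists F, is_forest e S F /\ fdepth F <= k) (dt k S).
Proof.
by move=> ac; apply: (iffP idP) => [/dt_forest | [F [/(forest_dt ac) +]]]; last apply.
Qed.
End Dtd.

(** * First-order formulas with transitive closure *)

(* Variables are binding levels: in a formula at level [d] the free variables are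
   below [d], and a binder takes the name [d]; [FTC x y f] is the reflexive
   transitive closure of the relation that [f] defines on the variables [d], [d+1]. *)
Inductive form :=
| FTrue
| FEdge of nat & nat
| FAnd of form & form
| FNot of form
| FEx of form
| FTC of nat & nat & form.

(** One number with two uses: it bounds the binding levels that the evaluation occupies, and it is
    the exponent of n+1 contributed by nested loops. A closure binds two levels but weighs 3, for
    its rounds and the two loops over pairs of vertices. *)
Fixpoint lev (f : form) : nat :=
  match f with
  | FTrue => 0
  | FEdge _ _ => 0
  | FAnd f g => maxn (lev f) (lev g)
  | FNot f => lev f
  | FEx f => 1 + lev f
  | FTC _ _ f => 3 + lev f
  end.

Fixpoint wf (d : nat) (f : form) : bool :=
  match f with
  | FTrue => true
  | FEdge x y => (x < d) && (y < d)
  | FAnd f g => wf d f && wf d g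
  | FNot f => wf d f
  | FEx f => wf d.+1 f
  | FTC x y f => [&& x < d, y < d & wf d.+2 f]
  end.

Definition setv (A : Type) (env : nat -> A) (d : nat) (v : A) : nat -> A :=
  fun x => if x == d then v else env x.

Fixpoint eval n (e : rel 'I_n) (d : nat) (f : form) (env : nat -> 'I_n) : bool :=
  match f with
  | FTrue => true
  | FEdge x y => e (env x) (env y)
  | FAnd f g => eval e d f env && eval e d g env
  | FNot f => ~~ eval e d f env
  | FEx f => [exists v, eval e d.+1 f (setv env d v)]
  | FTC x y f =>
      connect (fun a b => eval e d.+2 f (setv (setv env d a) d.+1 b)) (env x) (env y)
  end.

(* [S d u] says, at level [d], that the vertex [u] belongs to the set. *)
Definition setform := nat -> nat -> form.
Implicit Type S : setform.

Definition FOr f g := FNot (FAnd (FNot f) (FNot g)).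
Definition compF S v : setform := fun d u =>
  FAnd (S d u) (FTC v u (FAnd (S d.+2 d) (FAnd (S d.+2 d.+1)
    (FOr (FEdge d d.+1) (FEdge d.+1 d))))).
Definition reachF S s : setform := fun d u =>
  FAnd (S d u) (FTC s u (FAnd (S d.+2 d) (FAnd (S d.+2 d.+1) (FEdge d d.+1)))).
Definition sourceF S : setform := fun d s =>
  FAnd (S d s) (FNot (FEx (FAnd (S d.+1 d) (FEdge d s)))).
Definition diffF S S' : setform := fun d u => FAnd (S d u) (FNot (S' d u)).

Fixpoint dtF (k : nat) (S : setform) (d : nat) : form :=
  if k is k'.+1 then
    let C := compF S d in
    FNot (FEx (FAnd (S d.+1 d) (FNot (FEx (FAnd (sourceF C d.+2 d.+1)
      (dtF k' (diffF C (reachF C d.+1)) d.+2))))))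
  else FNot (FEx (S d.+1 d)).

(** The threshold [d0] leaves room for the parameters of a set formula, which are variables below
    [d0]; the formula is instantiated again under later binders, hence at every level from [d0]
    on. *)
Definition good S d0 l := forall d u, d0 <= d -> u < d ->
  wf d (S d u) /\ lev (S d u) <= l.

Lemma good_comp S d0 l v : v < d0 -> good S d0 l -> good (compF S v) d0 (l + 3).
Proof.
move=> vd gS d u led ltu; rewrite /=.
have [w1 l1] := gS d u led ltu.
have [|//|w2 l2] := gS d.+2 d; first by lia.
have [|//|w3 l3] := gS d.+2 d.+1; first by lia.
by rewrite w1 w2 w3 ltu (leq_trans vd led) /=; split; lia.
Qed.

Lemma good_reach S d0 l v : v < d0 -> good S d0 l -> good (reachF S v) d0 (l + 3).
Proof.
move=> vd gS d u led ltu; rewrite /=.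
have [w1 l1] := gS d u led ltu.
have [|//|w2 l2] := gS d.+2 d; first by lia.
have [|//|w3 l3] := gS d.+2 d.+1; first by lia.
by rewrite w1 w2 w3 ltu (leq_trans vd led) /=; split; lia.
Qed.

Lemma good_source S d0 l : good S d0 l -> good (sourceF S) d0 (l + 1).
Proof.
move=> gS d u led ltu; rewrite /=.
have [w1 l1] := gS d u led ltu.
have [|//|w2 l2] := gS d.+1 d; first by lia.
by rewrite w1 w2 /=; split; lia.
Qed.

Lemma good_diff S S' d0 l : good S d0 l -> good S' d0 l -> good (diffF S S') d0 l.
Proof.
move=> gS gS' d u led ltu; rewrite /=.
have [-> l1] := gS d u led ltu; have [-> l2] := gS' d u led ltu.
by split=> //; lia.
Qed.

Lemma good_mono S d0 d1 l l' : d0 <= d1 -> l <= l' -> good S d0 l -> good S d1 l'.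
Proof.
move=> led lel gS d u lt1 ltu; have [|//|-> l1] := gS d u; first exact: leq_trans lt1.
by split=> //; apply: leq_trans lel.
Qed.

(** One unfolding adds 2 for its quantifiers and turns [l] into [l + 6]: the component formula adds
    a closure over [S], and the reachability formula adds another over the component. *)
Lemma good_dtF k S d l : good S d l -> wf d (dtF k S d) /\ lev (dtF k S d) <= 8 * k + l + 1.
Proof.
elim: k S d l => [|k IH] S d l gS /=.
  by have [//|//|-> l1] := gS d.+1 d; split=> //; lia.
have [//|//|-> l1] := gS d.+1 d.
have gC : good (compF S d) d.+1 (l + 3).
  by apply: good_comp => //; apply: good_mono gS.
have gC2 := good_mono (leqnSn d.+1) (leqnn _) gC.
have [//|//|ws ls] := good_source gC2 (d := d.+2) (u := d.+1).
have gC' : good (diffF (compF S d) (reachF (compF S d) d.+1)) d.+2 (l + 6).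
  apply: good_diff; first by apply: good_mono gC2; lia.
  by apply: good_mono (good_reach _ gC2); lia.
have [w2 l2] := IH _ _ _ gC'.
move: ws ls w2 l2; rewrite /= => -> ls -> l2; split=> //; lia.
Qed.

(** * Semantics of the set formulas *)

Section Reps.
Variables (n : nat) (e : rel 'I_n).
Implicit Type env : nat -> 'I_n.

Definition agree d0 env0 env := forall x, x < d0 -> env x = env0 x.

(** Only the values below [d0] are fixed; variables bound later may take any value without changing
    the set that is denoted. This is what makes substitution under binders sound. *)
Definition reps S d0 env0 (A : {set 'I_n}) := forall d u env, d0 <= d -> u < d ->
  agree d0 env0 env -> eval e d (S d u) env = (env u \in A).

Lemma agree_setv d0 env0 env d v : d0 <= d -> agree d0 env0 env ->
  agree d0 env0 (setv env d v).
Proof. by move=> led H x ltx; rewrite /setv ltn_eqF ?H //; apply: leq_trans led. Qed.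

Lemma agree_setv2 d0 env0 env d v w : d0 <= d -> agree d0 env0 env ->
  agree d0 env0 (setv (setv env d v) d.+1 w).
Proof. by move=> led ag; do 2?apply: agree_setv => //; apply: leqW. Qed.

Lemma setvE (env : nat -> 'I_n) d v : setv env d v d = v.
Proof. by rewrite /setv eqxx. Qed.

Lemma setvN (env : nat -> 'I_n) d v x : x < d -> setv env d v x = env x.
Proof. by move=> ltx; rewrite /setv ltn_eqF. Qed.

Lemma reps_comp S d0 env0 A v : v < d0 -> reps S d0 env0 A ->
  reps (compF S v) d0 env0 (Defs.comp e A (env0 v)).
Proof.
move=> ltv rS d u env led ltu ag; rewrite /= rS // inE (ag v) //; congr (_ && _).
apply: eq_connect => a b; rewrite /und_edge negb_and !negbK.
rewrite !rS //; try (by apply: agree_setv2); try lia.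
by rewrite setvE setvN // setvE.
Qed.

Lemma reps_reach S d0 env0 A v : v < d0 -> reps S d0 env0 A ->
  reps (reachF S v) d0 env0 (reach e A (env0 v)).
Proof.
move=> ltv rS d u env led ltu ag; rewrite /= rS // inE (ag v) //; congr (_ && _).
apply: eq_connect => a b.
rewrite !rS //; try (by apply: agree_setv2); try lia.
by rewrite setvE setvN // setvE.
Qed.

Lemma reps_source S d0 env0 A : reps S d0 env0 A ->
  reps (sourceF S) d0 env0 (sources e A).
Proof.
move=> rS d u env led ltu ag; rewrite /= rS // inE; congr (_ && _).
rewrite negb_exists; apply: eq_forallb => v.
rewrite rS; try lia; last by apply: agree_setv.
by rewrite setvE setvN // negb_and implybE.
Qed.

Lemma reps_diff S S' d0 env0 A A' : reps S d0 env0 A -> reps S' d0 env0 A' ->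
  reps (diffF S S') d0 env0 (A :\: A').
Proof. by move=> rS rS' d u env led ltu ag; rewrite /= rS // rS' // inE andbC. Qed.

Lemma reps_push S d0 env0 A v : reps S d0 env0 A -> reps S d0.+1 (setv env0 d0 v) A.
Proof.
move=> rS d u env led ltu ag; apply: rS => //; first exact: ltnW.
by move=> x ltx; rewrite ag ?setvN //; lia.
Qed.

Lemma eval_dtF k S d env A : reps S d env A -> eval e d (dtF k S d) env = dt e k A.
Proof.
elim: k S d env A => [|k IH] S d env A rS /=.
  apply/idP/eqP => [|A0].
    rewrite negb_exists => /forallP H; apply/setP => v; rewrite inE.
    by have := H v; rewrite rS ?setvE // => [/negbTE //|]; apply: agree_setv.
  apply/existsP => -[v]; rewrite rS ?setvE ?A0 ?inE //; exact: agree_setv.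
rewrite negb_exists; apply: eq_forallb => v; set env1 := setv env d v.
have rS1 : reps S d.+1 env1 A by apply: reps_push.
have rC := reps_comp (ltnSn d) rS1.
rewrite (rS1 d.+1 d) // {1}/env1 setvE negb_and negbK implybE; congr (_ || _).
apply: eq_existsb => s; set env2 := setv env1 d.+1 s.
have rC2 : reps (compF S d) d.+2 env2 (Defs.comp e A v).
  by rewrite -[v](setvE env d v); apply: reps_push.
have /= -> := reps_source rC2 (d := d.+2) (u := d.+1) (env := env2) (leqnn _) (ltnSn _) (fun _ _ => erefl).
have env2s : env2 d.+1 = s by apply: setvE.
rewrite env2s; congr (_ && _); apply: IH.
apply: reps_diff => //.
by have := reps_reach (ltnSn d.+1) rC2; rewrite env2s.
Qed.

Definition setT_form : setform := fun _ _ => FTrue.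
Lemma eval_dtd k env : eval e 0 (dtF k setT_form 0) env = dt e k [set: 'I_n].
Proof. by apply: eval_dtF => d u env' _ _ _; rewrite /= inE. Qed.
End Reps.

(** * Evaluating formulas *)

(** Decrementing and then incrementing a register that is at most 1 sets it to 1. For [FEx] the flag
    collects the disjunction over all vertices and is reset once copied to register 3; for [FTC] the
    array of level [d] marks the reached vertices and the flag counts the rounds left. *)
Fixpoint compile (D d : nat) (f : form) : lcmd :=
  match f with
  | FTrue => Ldec 3 ;; Linc 3
  | FEdge x y => edge_read D (idx x) (idx y)
  | FAnd f g => compile D d f ;; Lif 3 (compile D d g) Lskip
  | FNot f => compile D d f ;; Lif 3 (Ldec 3) (Linc 3)
  | FEx f =>
      for_ d (compile D d.+1 f ;; Lif 3 (Ldec (flg d) ;; Linc (flg d)) Lskip) ;;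
      Ldec 3 ;; Lif (flg d) (Ldec (flg d) ;; Linc 3) Lskip
  | FTC x y f =>
      for_ d (Ldec 3 ;; arr_write D d (idx d)) ;;
      Ldec 3 ;; Linc 3 ;; arr_write D d (idx x) ;;
      addto 0 (flg d) ;;
      Lwhile (flg d) (Ldec (flg d) ;;
        for_ d (for_ d.+1 (arr_read D d (idx d) ;;
          Lif 3 (compile D d.+2 f ;; Lif 3 (arr_write D d (idx d.+1)) Lskip) Lskip))) ;;
      arr_read D d (idx y)
  end.

Lemma upd_loop d m i c : let m' := upd (upd m (idx d) i) (cnt d) c in
  [/\ m' (idx d) = i, m' (cnt d) = c & forall a, ~~ (idx d <= a <= cnt d) -> m' a = m a].
Proof.
split=> [||a]; rewrite ?updE ?eqxx //; first by rewrite ifN_eq ?eqxx //; unregs; lia.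
by unregs => H; rewrite !ifN_eq //; lia.
Qed.

Ltac ups := rewrite /upd; unregs; repeat (case: eqP => ?); lia.

(** * Memory invariants, and correctness of the first-order connectives *)

Section Ok.
Variables (D n : nat) (e : rel 'I_n).
Implicit Type env : nat -> 'I_n.

Definition input_ok (m : nat -> nat) := forall i j : 'I_n,
  let p := 1 + i * n + j in m (if nreg D <= p then p else base D n + p) = e i j.

Record ok (d : nat) env (m : nat -> nat) : Prop := Ok {
  ok_n : m 0 = n;
  ok_base : m 2 = base D n;
  ok_res : m 3 <= 1;
  ok_tmp : forall a, 4 <= a < 7 -> m a = 0;
  ok_free : forall a, idx d <= a < nreg D -> m a = 0;
  ok_env : forall x, x < d -> m (idx x) = env x;
  ok_input : input_ok m }.

(** Every register except 3 must be restored, even those of level [d] and above, so that the next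
    evaluation finds them zero again. Arrays of levels from [d] on are scratch; those of enclosing
    closures are protected. *)
Definition frame (d : nat) (m m' : nat -> nat) :=
  forall a, a != 3 -> a < arr D n d 0 -> m' a = m a.

Lemma arr_lt d : arr D n 0 0 <= arr D n d 0. Proof. by unregs; nia. Qed.

Lemma input_addr (i j : 'I_n) : let p := 1 + i * n + j in
  nreg D <= (if nreg D <= p then p else base D n + p) < arr D n 0 0.
Proof.
have := ltn_ord i; have := ltn_ord j; move=> hj hi /=.
have : 1 + i * n + j <= n * n by nia.
by unregs; case: ifP; lia.
Qed.

Lemma ok_ext d d' env env' (m m' : nat -> nat) : ok d env m ->
  (forall a, a < 7 -> a != 3 -> m' a = m a) -> m' 3 <= 1 ->
  (forall a, nreg D <= a < arr D n 0 0 -> m' a = m a) ->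
  (forall a, idx d' <= a < nreg D -> m' a = 0) ->
  (forall x, x < d' -> m' (idx x) = env' x) -> ok d' env' m'.
Proof.
move=> [m0 m2 m3 mt mf me mi] Hlo H3 Hhi Hf He; split=> //.
- by rewrite Hlo.
- by rewrite Hlo.
- by move=> a Ha; rewrite Hlo ?mt //; lia.
- by move=> i j /=; rewrite Hhi; [exact: mi | exact: input_addr].
Qed.

Lemma ok_frame d env m m' : d <= D -> ok d env m -> frame d m m' -> m' 3 <= 1 -> ok d env m'.
Proof.
move=> led o Hf H3; apply: ok_ext (o) _ _ _ _ _ => //.
- by move=> a lta a3; apply: Hf => //; unregs; lia.
- by move=> a /andP[gea lta]; apply: Hf; [move: gea; rewrite /nreg; lia | exact: leq_trans (arr_lt d)].
- move=> a Ha; rewrite Hf ?(ok_free o) //; move: Ha; unregs; lia.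
- by move=> x ltx; rewrite Hf ?(ok_env o) //; unregs; lia.
Qed.

Lemma ok_push d env m m' (v : 'I_n) : d < D -> ok d env m ->
  (forall a, a != 3 -> a < arr D n d 0 -> ~~ (idx d <= a <= flg d) -> m' a = m a) ->
  m' 3 <= 1 -> m' (idx d) = v -> ok d.+1 (setv env d v) m'.
Proof.
move=> led o Hf H3 Hv; apply: ok_ext (o) _ _ _ _ _ => //.
- by move=> a lta a3; apply: Hf => //; unregs; lia.
- move=> a /andP[gea lta]; apply: Hf; first by move: gea; rewrite /nreg; lia.
    exact: leq_trans (arr_lt d).
  by move: gea; unregs; lia.
- move=> a Ha; rewrite Hf ?(ok_free o) //; move: Ha; unregs; lia.
- move=> x; rewrite ltnS leq_eqVlt => /predU1P[->|ltx]; first by rewrite setvE.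
  rewrite setvN // Hf ?(ok_env o) //; unregs; lia.
Qed.

Definition correct d f env (m m' : nat -> nat) : Prop :=
  m' 3 = eval e d f env /\ frame d m m'.

Lemma correct_ok d f env m m' : d <= D -> ok d env m -> correct d f env m m' -> ok d env m'.
Proof.
by move=> led o [H3 Hf]; apply: ok_frame Hf _ => //; rewrite H3; case: eval.
Qed.

Definition spec B f := forall d env m, ok d env m -> d + lev f <= D -> wf d f ->
  wp (compile D d f) B (correct d f env m) m.

Lemma spec_true : spec 2 FTrue.
Proof.
move=> d env m o _ _; apply: (@wp_seq _ _ 1 1); apply: wp_dec; apply: wp_inc => //.
split; first by rewrite /upd /=; have := ok_res o; lia.
by move=> a a3 lta; rewrite !updE (negbTE a3).
Qed.

Lemma spec_edge x y : spec ((120 + 60 * nreg D) * n.+1 ^ 2) (FEdge x y).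
Proof.
move=> d env m o led /= /andP[ltx lty].
apply: (@wp_edge_read D n _ _ (env x) (env y)) => //; try (by unregs; lia);
  try exact: ok_n o; try exact: ok_base o; try (by apply: ok_tmp o _ _); try exact: ok_env o _ _.
split; first by rewrite updE eqxx; exact: ok_input o _ _.
by move=> a a3 lta; rewrite updE (negbTE a3).
Qed.

Lemma spec_and f g B1 B2 : spec B1 f -> spec B2 g -> spec (B1 + (B2 + 2)) (FAnd f g).
Proof.
move=> Hf Hg d env m o /= led /andP[wff wfg]; apply: wp_seq.
apply: wp_mono (Hf d env m o _ wff) (leqnn _) _; first by lia.
move=> m1 _ c1; have o1 := correct_ok _ o c1; case: c1 => r1 f1.
apply: wp_if => Hr.
  apply: wp_mono (Hg d env m1 _ _ wfg) (leqnn _) _; [apply: o1; lia | lia |].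
  move=> m2 _ [r2 f2]; split.
    by rewrite r2 /=; case: eval r1 Hr => // ->.
  by move=> a a3 lta; rewrite f2 ?f1.
apply: wp_le (wp_skip _) (leq0n _); split=> //.
by rewrite r1 /=; case: eval r1 Hr => // ->.
Qed.

Lemma spec_not f B : spec B f -> spec (B + 3) (FNot f).
Proof.
move=> Hf d env m o /= led wff; apply: wp_seq.
apply: wp_mono (Hf d env m o _ wff) (leqnn _) _ => //.
move=> m1 _ [r1 f1]; apply: (@wp_if _ _ _ 1) => Hr; [apply: wp_dec | apply: wp_inc => //]; split.
- by rewrite updE eqxx r1 /=; case: eval r1 Hr => // ->.
- by move=> a a3 lta; rewrite updE (negbTE a3) f1.
- by rewrite updE eqxx r1 /=; case: eval r1 Hr => // ->.
- by move=> a a3 lta; rewrite updE (negbTE a3) f1.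
Qed.

Lemma spec_ex f B : spec B f -> spec ((B + 24) * n.+1 + 5) (FEx f).
Proof.
move=> Hf d env m o /= led wff.
have ltd : d < D by lia.
(* The flag tells whether a witness occurred among the first [i] vertices. It is exempt from the
   frame condition until it is reset after the loop. *)
pose J i (m' : nat -> nat) := [/\ m' 3 <= 1, m' (flg d) = [exists v : 'I_n, (v < i) && eval e d.+1 f (setv env d v)]
  & forall a, a != 3 -> a < arr D n d 0 -> a != flg d -> m' a = m a].
apply: wp_le (_ : (B + 4 + 20) * n.+1 + (1 + (2 + 2)) <= _); last by lia.
apply: wp_seq; apply: wp_mono (wp_for (J := J) (B := B + 4) (ok_n o) _ _ _ _ _) (leqnn _) _.
- exact: ok_tmp o _ _.
- by apply: ok_free o _ _; unregs; lia.
- by apply: ok_free o _ _; unregs; lia.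
- split=> //; first exact: ok_res o.
  rewrite (ok_free o); last by unregs; lia.
  by case: existsP => // -[v]; rewrite ltn0.
- move=> i m1 ltin m1i m1c [m1r m1f m1a].
  set m1' := upd _ _ _.
  have [m1'i m1'c m1'E] : [/\ m1' (idx d) = i, m1' (cnt d) = n - i &
    forall a, ~~ (idx d <= a <= cnt d) -> m1' a = m1 a] := upd_loop d m1 i (n - i).
  have o1 : ok d.+1 (setv env d (Ordinal ltin)) m1'.
    apply: (ok_push (v := Ordinal ltin) ltd o _ _ m1'i) => //.
    by move=> a a3 lta Ha; rewrite m1'E ?m1a //; move: Ha; unregs; lia.
  apply: wp_seq; apply: wp_mono (Hf _ _ _ o1 _ wff) (leqnn _) _; first by lia.
  move=> m2 _ [r2 f2].
  have m2E a : a != 3 -> a < arr D n d 0 -> m2 a = m1' a.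
    by move=> a3 lta; apply: f2 => //; apply: leq_trans lta _; unregs; lia.
  have E : [exists v : 'I_n, (v < i.+1) && eval e d.+1 f (setv env d v)] =
    eval e d.+1 f (setv env d (Ordinal ltin)) ||
     [exists v : 'I_n, (v < i) && eval e d.+1 f (setv env d v)].
    apply/existsP/orP => [[v /andP[+ ev]]|[ev|/existsP[v /andP[ltv ev]]]].
    + rewrite ltnS leq_eqVlt => /predU1P[Ev|ltv]; [left|right].
        by rewrite (_ : Ordinal ltin = v) //; apply: val_inj.
      by apply/existsP; exists v; rewrite ltv.
    + by exists (Ordinal ltin); rewrite /= leqnn.
    + by exists v; rewrite ev (leqW ltv).
  have m2i : m2 (idx d) = i by rewrite m2E //; unregs; lia.
  have m2c : m2 (cnt d) = n - i by rewrite m2E //; unregs; lia.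
  have m2f : m2 (flg d) = m1 (flg d) by rewrite m2E ?m1'E //; unregs; lia.
  have clr_m2 a : a != 3 -> a < arr D n d 0 -> clr d m2 a = m1 a.
    move=> a3 lta; rewrite /clr !updE; case: (eqVneq a (cnt d)) => [->|ac]; first by rewrite m1c.
    case: (eqVneq a (idx d)) => [->|ai]; first by rewrite m1i.
    by rewrite m2E // m1'E //; move: ac ai; unregs; lia.
  have clr3 : clr d m2 3 = m2 3 by rewrite /clr; ups.
  rewrite r2 in clr3.
  apply: (@wp_if _ _ _ 2) => Hr.
    have ev : eval e d.+1 f (setv env d (Ordinal ltin)) by case: eval r2 Hr => // ->.
    apply: (@wp_seq _ _ 1 1); apply: wp_dec; apply: wp_inc => //; split.
    + by move: m2i; ups.
    + by move: m2c; ups.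
    set m3 := clr d (upd _ _ _).
    have m3E a : a != flg d -> m3 a = clr d m2 a by rewrite /m3 /clr; ups.
    split.
    + by rewrite m3E ?clr3 //; case: eval.
    + rewrite E ev; suff -> : m3 (flg d) = (m2 (flg d)).-1.+1 by rewrite m2f m1f; case: existsP.
      by rewrite /m3 /clr; ups.
    + by move=> a a3 lta af; rewrite m3E // clr_m2 // m1a.
  apply: wp_le (wp_skip _) (leq0n _); split => //; split.
  + by rewrite clr3; case: eval.
  + have /negbTE ev : ~~ eval e d.+1 f (setv env d (Ordinal ltin)) by case: eval r2 Hr => // ->.
    by rewrite E ev clr_m2 ?m1f //; unregs; lia.
  + by move=> a a3 lta af; rewrite clr_m2 // m1a.
move=> m1 _ [r1 f1 Ha]; apply/wp_seq/wp_dec.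
have E : [exists v : 'I_n, (v < n) && eval e d.+1 f (setv env d v)] =
   [exists v : 'I_n, eval e d.+1 f (setv env d v)] by apply: eq_existsb => v; rewrite ltn_ord.
have fd0 : m (flg d) = 0 by rewrite (ok_free o) //; unregs; lia.
have f3 : flg d != 3 by unregs; lia.
rewrite E in f1.
apply: wp_if; rewrite updE (negbTE f3) f1 => Hr.
  apply: (@wp_seq _ _ 1 1); apply: wp_dec; apply: wp_inc => //; split.
    by rewrite /=; case: existsP Hr => // _ _; ups.
  move=> a a3 lta; rewrite !updE (negbTE a3) (negbTE f3) f1.
  by case: eqP => [->|/eqP af]; [rewrite fd0; case: existsP | rewrite Ha].
apply: wp_le (wp_skip _) (leq0n _); split.
  by rewrite /= Hr /upd /=; lia.
move=> a a3 lta; rewrite !updE (negbTE a3).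
by case: (eqVneq a (flg d)) => [->|af]; [rewrite fd0 f1 | rewrite Ha].
Qed.
End Ok.

(** * Transitive closure by relaxation in place *)

Section TC.
Variables (D n : nat) (e : rel 'I_n) (d : nat) (env : nat -> 'I_n) (m : nat -> nat).
Hypothesis m_ok : ok D e d env m.
Hypothesis d_lt : d.+1 < D.

Let W := (120 + 60 * nreg D) * n.+1 ^ 2.

Definition holds (m0 : nat -> nat) (A : {set 'I_n}) (m' : nat -> nat) : Prop :=
  [/\ m' 3 <= 1, forall i : 'I_n, m' (arr D n d i) = (i \in A) & frame D n d m0 m'].

(** The reference is the memory [m] at the start of the whole evaluation, and [t] is the last
    register of the loops that may have changed since. *)
Definition near (t : nat) (m' : nat -> nat) : Prop := forall a, a != 3 ->
  a < arr D n d 0 -> ~~ (idx d <= a <= t) -> m' a = m a.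

(** Index and counter are zero before the loop and zeroed again by [clr], so a frame condition
    against the memory inside the loop becomes one against the memory before it. *)
Lemma holds_clr d' m0 (A A' : {set 'I_n}) m2 m3 i c : d' < D ->
  m0 (idx d') = 0 -> m0 (cnt d') = 0 -> holds m0 A m2 ->
  holds (upd (upd m2 (idx d') i) (cnt d') c) A' m3 ->
  [/\ m3 (idx d') = i, m3 (cnt d') = c & holds m0 A' (clr d' m3)].
Proof.
move=> ltd mi mc [H3 HA Hf] [H3' HA' Hf'].
have [ei ec eE] := upd_loop d' m2 i c.
have lti : idx d' < arr D n d 0 by unregs; lia.
have ltc : cnt d' < arr D n d 0 by unregs; lia.
split; [by rewrite Hf' | by rewrite Hf' |].
split; first by move: H3'; rewrite /clr; ups.
  by move=> j; rewrite -HA' /clr !updE !ifN_eq //; unregs; lia.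
move=> a a3 lta; rewrite /clr !updE.
case: (eqVneq a (cnt d')) => [->//|ac]; case: (eqVneq a (idx d')) => [->//|ai].
by rewrite Hf' // eE ?Hf //; move: ac ai; unregs; lia.
Qed.

Lemma near_tmp t m' : near t m' -> [/\ m' 0 = n, m' 2 = base D n, m' 4 = 0, m' 5 = 0 & m' 6 = 0].
Proof.
by move=> Hm; split; rewrite Hm ?(ok_n m_ok) ?(ok_base m_ok) ?(ok_tmp m_ok) //; unregs; lia.
Qed.

Lemma ok_near2 m' (u v : 'I_n) : near (flg d.+1) m' -> m' 3 <= 1 ->
  m' (idx d) = u -> m' (idx d.+1) = v -> ok D e d.+2 (setv (setv env d u) d.+1 v) m'.
Proof.
move=> Hf H3 Hu Hv; apply: ok_ext (m_ok) _ _ _ _ _ => //.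
- by move=> a lta a3; apply: Hf => //; unregs; lia.
- move=> a /andP[gea lta]; apply: Hf; first by move: gea; rewrite /nreg; lia.
    exact: leq_trans (arr_lt D n d).
  by move: gea; unregs; lia.
- move=> a Ha; rewrite Hf ?(ok_free m_ok) //; move: Ha; unregs; lia.
- move=> x; rewrite ltnS leq_eqVlt => /predU1P[->|]; first by rewrite setvE.
  move=> ltx; rewrite setvN //; move: ltx; rewrite ltnS leq_eqVlt => /predU1P[->|ltx].
    by rewrite setvE.
  rewrite setvN // Hf ?(ok_env m_ok) //; unregs; lia.
Qed.

Lemma wp_tc_init : wp (for_ d (Ldec 3 ;; arr_write D d (idx d))) ((1 + W + 20) * n.+1)
  (holds m set0) m.
Proof.
have mi : m (idx d) = 0 by rewrite (ok_free m_ok) //; unregs; lia.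
have mc : m (cnt d) = 0 by rewrite (ok_free m_ok) //; unregs; lia.
have [t0 t2 t4 t5 t6] : [/\ m 0 = n, m 2 = base D n, m 4 = 0, m 5 = 0 & m 6 = 0] by apply: (@near_tmp 0).
pose J j (m' : nat -> nat) := [/\ m' 3 <= 1, forall i : 'I_n, i < j -> m' (arr D n d i) = 0 & frame D n d m m'].
apply: wp_mono (wp_for (J := J) (B := 1 + W) t0 t5 mi mc _ _) (leqnn _) _.
- by split=> //; exact: ok_res m_ok.
- move=> j m2 ltj m2i m2c [m23 m2A m2f].
  set m2' := upd _ _ _.
  have [m2'i m2'c m2'E] : [/\ m2' (idx d) = j, m2' (cnt d) = n - j &
    forall a, ~~ (idx d <= a <= cnt d) -> m2' a = m2 a] := upd_loop d m2 j (n - j).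
  have m2'lo a : a < 7 -> a != 3 -> m2' a = m a.
    by move=> lta a3; rewrite m2'E ?m2f //; unregs; lia.
  have m2'3 : m2' 3 = m2 3 by rewrite m2'E.
  apply: wp_seq; apply: wp_dec.
  have -> : (m2' 3).-1 = 0 by rewrite m2'3; lia.
  have [u0 u2 u4 u5] : [/\ m2' 0 = n, m2' 2 = base D n, m2' 4 = 0 & m2' 5 = 0].
    by split; rewrite m2'lo.
  apply: (wp_arr_write (i := j) (n := n)) => //; try lia.
  set m3 := upd _ _ _.
  have m3E a : a != 3 -> a < arr D n d 0 -> m3 a = m2' a.
    move=> a3 lta; rewrite /m3 !updE (negbTE a3) ifN_eq //.
    by rewrite neq_ltn (leq_trans lta) //; unregs; lia.
  split; [by rewrite m3E //; unregs; lia | by rewrite m3E //; unregs; lia|].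
  split.
  + by rewrite /clr /m3; ups.
  + move=> i lti; rewrite /clr !updE !ifN_eq; try by unregs; lia.
    rewrite /m3 !updE; case: eqP => // /eqP nij; rewrite ifN_eq; last by unregs; lia.
    rewrite m2'E; last by unregs; lia.
    by apply: m2A; move: nij; rewrite /arr eqn_add2l; lia.
  + move=> a a3 lta; rewrite /clr !updE.
    case: (eqVneq a (cnt d)) => [->//|ac]; case: (eqVneq a (idx d)) => [->//|ai].
    by rewrite m3E // m2'E ?m2f //; move: ac ai; unregs; lia.
by move=> m' _ [h3 hA hf]; split=> // i; rewrite inE hA.
Qed.
Variables (f : form) (B : nat) (x0 : 'I_n).
Hypothesis f_spec : spec D e B f.
Hypothesis f_le : d + (3 + lev f) <= D.
Hypothesis f_wf : wf d.+2 f.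

Let r : rel 'I_n := fun a b => eval e d.+2 f (setv (setv env d a) d.+1 b).
Let R := [set b | connect r x0 b].

Definition tc_body := arr_read D d (idx d) ;;
  Lif 3 (compile D d.+2 f ;; Lif 3 (arr_write D d (idx d.+1)) Lskip) Lskip.

Lemma wp_tc_body m1 (A : {set 'I_n}) (u v : 'I_n) : near (flg d.+1) m1 -> m1 3 <= 1 ->
  (forall i : 'I_n, m1 (arr D n d i) = (i \in A)) ->
  m1 (idx d) = u -> m1 (idx d.+1) = v ->
  wp tc_body (W + (B + (W + 2) + 2))
     (holds m1 (if (u \in A) && r u v then v |: A else A)) m1.
Proof.
move=> near1 m13 HA Hu Hv; have [t0 t2 t4 t5 t6] := near_tmp near1.
apply: wp_seq; apply: (wp_arr_read (i := u) (n := n)) => //; [lia | rewrite HA].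
set m2 := upd _ _ _.
have m2E a : a != 3 -> m2 a = m1 a by move=> a3; rewrite /m2 updE (negbTE a3).
have m2A (i : 'I_n) : m2 (arr D n d i) = (i \in A).
  by rewrite m2E ?HA //; unregs; lia.
have m23 : m2 3 = (u \in A) by [].
have near2 : near (flg d.+1) m2 by move=> a a3 lta Ha; rewrite m2E // near1.
have m23' : m2 3 <= 1 by rewrite m23; case: (u \in A).
apply: wp_if => Hr; last first.
  apply: wp_le (wp_skip _) (leq0n _).
  have /negbTE -> : u \notin A by case: (u \in A) m23 Hr => // ->.
  by split=> // a a3 lta; rewrite m2E.
have -> : u \in A by case: (u \in A) m23 Hr => // ->.
have o2 : ok D e d.+2 (setv (setv env d u) d.+1 v) m2.
  by apply: ok_near2 => //; rewrite m2E.
apply: wp_seq; apply: wp_mono (f_spec o2 _ f_wf) (leqnn _) _; first by lia.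
move=> m3 _ [r3 f3].
(* [arr D n d n] is the end of the array of level [d]; the evaluation of [f] at level [d.+2] writes
   to no array cell before that point. *)
have m3E a : a != 3 -> a < arr D n d n -> m3 a = m1 a.
  move=> a3 lta; rewrite f3 ?m2E //; apply: leq_trans lta _.
  by rewrite /arr !mulSn; lia.
have m3A (i : 'I_n) : m3 (arr D n d i) = (i \in A).
  rewrite m3E ?HA //; unregs; first by lia.
  by have := ltn_ord i; lia.
have lt0n a : a < arr D n d 0 -> a < arr D n d n by move=> lta; apply: leq_trans lta _; unregs; lia.
apply: wp_if => Hr3; last first.
  apply: wp_le (wp_skip _) (leq0n _).
  have /negbTE -> : ~~ r u v by rewrite /r; case: eval r3 Hr3 => // ->.
  split=> //; first by rewrite r3; case: eval.
  by move=> a a3 lta; rewrite m3E ?lt0n.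
have ruv : r u v by rewrite /r; case: eval r3 Hr3 => // ->.
rewrite ruv; rewrite -/(r u v) ruv in r3.
have lo3 a : a < 7 -> a != 3 -> m3 a = m1 a.
  by move=> lta a3; apply: m3E => //; unregs; lia.
have m3v : m3 (idx d.+1) = v by rewrite m3E //; unregs; lia.
have [u0 u2 u4 u5] : [/\ m3 0 = n, m3 2 = base D n, m3 4 = 0 & m3 5 = 0].
  by split; rewrite lo3.
(* Register 3 holds the truth value of [f], which is 1 here, so storing it marks [v]. *)
apply: (wp_arr_write (i := v) (n := n)) => //; try lia.
split.
- by rewrite updE r3; case: eqP.
- move=> i; rewrite updE r3 m3A !inE /arr eqn_add2l.
  by rewrite -(inj_eq val_inj); case: eqVneq.
- move=> a a3 lta; rewrite updE ifN_eq ?m3E ?lt0n //.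
  by rewrite neq_ltn (leq_trans lta) //; unregs; lia.
Qed.

(** Marks are updated in place, so a round may already use vertices that it has just added. It then
    only needs bounds from both sides: nothing outside [R] is marked, and successors of the set [A]
    from the start of the round are. *)
Lemma subset_step (A A' : {set 'I_n}) u v : A' \subset R -> A \subset A' ->
  let A'' := if (u \in A') && r u v then v |: A' else A' in
  [/\ A'' \subset R, A' \subset A'' & u \in A -> r u v -> v \in A''].
Proof.
move=> sR sA /=; case: ifP => [/andP[uA' ruv]|nuv]; split=> //.
- apply/subsetP => b; rewrite inE => /orP[/set1P ->|/(subsetP sR) //].
  by have := subsetP sR u uA'; rewrite !inE => H; apply: connect_trans H (connect1 _).
- by apply/subsetP => b bA; rewrite inE bA orbT.
- by rewrite !inE eqxx.
- by move=> uA ruv; move: nuv; rewrite ruv (subsetP sA).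
Qed.

Let Bb := W + (B + (W + 2) + 2).

Lemma wp_tc_inner m1 (A : {set 'I_n}) (u : 'I_n) : near (flg d) m1 -> m1 3 <= 1 ->
  (forall i : 'I_n, m1 (arr D n d i) = (i \in A)) -> A \subset R ->
  m1 (idx d) = u ->
  wp (for_ d.+1 tc_body) ((Bb + 20) * n.+1) (fun m' => exists A' : {set 'I_n},
    [/\ holds m1 A' m', A \subset A', A' \subset R &
        forall v, u \in A -> r u v -> v \in A']) m1.
Proof.
move=> near1 m13 HA sR Hu; have [t0 t2 t4 t5 t6] := near_tmp near1.
have mi : m1 (idx d.+1) = 0 by rewrite near1 ?(ok_free m_ok) //; unregs; lia.
have mc : m1 (cnt d.+1) = 0 by rewrite near1 ?(ok_free m_ok) //; unregs; lia.
pose J j m' := exists A' : {set 'I_n}, [/\ holds m1 A' m', A \subset A', A' \subset R &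
        forall v : 'I_n, v < j -> u \in A -> r u v -> v \in A'].
apply: wp_mono (wp_for (J := J) (B := Bb) t0 t5 mi mc _ _) (leqnn _) _.
- by exists A; split.
- move=> j m2 ltj m2i m2c [A' [h2 sA sA'R Hv]].
  set m2' := upd _ _ _.
  have [m2'i m2'c m2'E] : [/\ m2' (idx d.+1) = j, m2' (cnt d.+1) = n - j &
    forall a, ~~ (idx d.+1 <= a <= cnt d.+1) -> m2' a = m2 a] := upd_loop d.+1 m2 j (n - j).
  have [h23 h2A h2f] := h2.
  apply: wp_mono (wp_tc_body (A := A') (u := u) (v := Ordinal ltj) _ _ _ _ _) (leqnn _) _ => //.
  + move=> a a3 lta Ha; rewrite m2'E; last by move: Ha; unregs; lia.
    by rewrite h2f // near1 //; move: Ha; unregs; lia.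
  + by move=> i; rewrite m2'E ?h2A //; unregs; lia.
  + by rewrite m2'E ?h2f //; unregs; lia.
  set A'' := if _ then _ else _.
  move=> m3 _ h3; have [sR'' sA'' Hj] := subset_step u (Ordinal ltj) sA'R sA.
  have [|e1 e2 h3'] := holds_clr _ mi mc h2 h3; first by lia.
  split=> //; exists A''; split=> //; first exact: subset_trans sA''.
  move=> v; rewrite ltnS leq_eqVlt => /predU1P[Ev|ltv].
    by rewrite (_ : v = Ordinal ltj) //; apply: val_inj.
  by move=> uA ruv; apply: (subsetP sA''); apply: Hv.
by move=> m' _ [A' [h sA sA' Hv]]; exists A'; split=> // v; apply: Hv.
Qed.

Lemma wp_tc_outer m1 (A : {set 'I_n}) : near (flg d) m1 -> m1 3 <= 1 ->
  (forall i : 'I_n, m1 (arr D n d i) = (i \in A)) -> A \subset R ->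
  m1 (idx d) = 0 -> m1 (cnt d) = 0 ->
  wp (for_ d (for_ d.+1 tc_body)) (((Bb + 20) * n.+1 + 20) * n.+1)
   (fun m' => exists A' : {set 'I_n}, [/\ holds m1 A' m', A \subset A', A' \subset R &
        forall u v, u \in A -> r u v -> v \in A']) m1.
Proof.
move=> near1 m13 HA sR mi mc; have [t0 t2 t4 t5 t6] := near_tmp near1.
pose J j m' := exists A' : {set 'I_n}, [/\ holds m1 A' m', A \subset A', A' \subset R &
        forall u v : 'I_n, u < j -> u \in A -> r u v -> v \in A'].
apply: wp_mono (wp_for (J := J) (B := (Bb + 20) * n.+1) t0 t5 mi mc _ _) (leqnn _) _.
- by exists A; split.
- move=> j m2 ltj m2i m2c [A' [h2 sA sA'R Hv]].
  set m2' := upd _ _ _.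
  have [m2'i m2'c m2'E] : [/\ m2' (idx d) = j, m2' (cnt d) = n - j &
    forall a, ~~ (idx d <= a <= cnt d) -> m2' a = m2 a] := upd_loop d m2 j (n - j).
  have [h23 h2A h2f] := h2.
  apply: wp_mono (wp_tc_inner (A := A') (u := Ordinal ltj) _ _ _ _ _) (leqnn _) _ => //.
  + move=> a a3 lta Ha; rewrite m2'E; last by move: Ha; unregs; lia.
    by rewrite h2f // near1 //; move: Ha; unregs; lia.
  + by move=> i; rewrite m2'E ?h2A //; unregs; lia.
  move=> m3 _ [A'' [h3 sA'' sR'' Hj]].
  have [|e1 e2 h3'] := holds_clr _ mi mc h2 h3; first by lia.
  split=> //; exists A''; split=> //; first exact: subset_trans sA''.
  move=> u v; rewrite ltnS leq_eqVlt => /predU1P[Eu|ltu] uA ruv.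
    by apply: Hj; rewrite (_ : Ordinal ltj = u) ?(subsetP sA) //; apply: val_inj.
  by apply: (subsetP sA''); apply: Hv ruv.
by move=> m' _ [A' [h sA sA' Hv]]; exists A'; split=> // u v; apply: Hv.
Qed.

Definition tc_loop := Lwhile (flg d) (Ldec (flg d) ;; for_ d (for_ d.+1 tc_body)).

Lemma wp_tc_loop m1 : holds (upd m (flg d) n) [set x0] m1 ->
  wp tc_loop (n * (1 + ((Bb + 20) * n.+1 + 20) * n.+1 + 2) + 1) (holds m R) m1.
Proof.
move=> h1.
have ltf : flg d < arr D n d 0 by unregs; lia.
have mi : m (idx d) = 0 by rewrite (ok_free m_ok) //; unregs; lia.
have mc : m (cnt d) = 0 by rewrite (ok_free m_ok) //; unregs; lia.
have mf : m (flg d) = 0 by rewrite (ok_free m_ok) //; unregs; lia.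
(* After [n - k] rounds the array contains the ends of all [r]-paths from [x0] of length at most
   [n - k], and possibly ends of longer ones. *)
pose I k m' := k <= n /\ exists A : {set 'I_n}, [/\ holds (upd m (flg d) k) A m', A \subset R &
   forall p, path r x0 p -> size p <= n - k -> last x0 p \in A].
have If k m' : I k m' -> m' (flg d) = k.
  by move=> [_ [A [[_ _ Hf] _ _]]]; rewrite Hf // updE eqxx.
apply: wp_mono (wp_while (I := I) (k := n) _ _ _ _) (leqnn _) _.
- by move=> k m' /If ->.
- by move=> m' /If.
- move=> k m' HI; have Hfl := If _ _ HI.
  case: HI => [lek [A [[H3 HA Hf] sR Hp]]].
  apply: wp_seq; apply: wp_dec; rewrite Hfl /=.
  set m2 := upd _ _ _.
  have m2E a : a != 3 -> a < arr D n d 0 -> m2 a = upd m (flg d) k a.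
    move=> a3 lta; rewrite /m2 !updE; case: eqP => // /eqP af.
    by rewrite Hf // updE (negbTE af).
  have m23 : m2 3 <= 1 by rewrite /m2 updE.
  apply: wp_mono (wp_tc_outer (A := A) _ _ _ _ _ _) (leqnn _) _ => //.
  + move=> a a3 lta Ha; rewrite m2E // updE ifN_eq //.
    by move: Ha; unregs; lia.
  + by move=> i; rewrite /m2 updE ifN_eq ?HA //; unregs; lia.
  + by rewrite m2E ?updE ?ifN_eq //; unregs; lia.
  + by rewrite m2E ?updE ?ifN_eq //; unregs; lia.
  move=> m3 _ [A' [[h3 hA hf] sA sR' Huv]]; split; first exact: ltnW.
  exists A'; split=> //.
    by split=> // a a3 lta; rewrite hf // m2E.
  move=> p; case/lastP: p => [_ _|p b]; first by apply/(subsetP sA)/(Hp [::]).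
  rewrite rcons_path last_rcons size_rcons => /andP[pp rb] ltp.
  by apply: Huv rb; apply: Hp => //; lia.
- split=> //; exists [set x0]; split=> //.
    by apply/subsetP => b /set1P ->; rewrite inE connect0.
  by rewrite subnn => -[|//] _ _; rewrite inE.
move=> m' _ [_ [A [[H3 HA Hf] sR Hp]]].
have -> : R = A.
  apply/eqP; rewrite eqEsubset sR andbT; apply/subsetP => b; rewrite inE => /connectP[p pp ->].
  (* A path without repeated vertices has fewer than [n] edges, so [n] rounds suffice. *)
  case/shortenP: pp => q pq uq _; apply: Hp => //.
  have := card_uniqP uq; rewrite /= => Hc; rewrite subn0 ltnW // -Hc -[n in _ <= n]card_ord.
  exact: max_card.
split=> // a a3 lta; rewrite Hf // updE; case: eqP => // ->.
by rewrite mf.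
Qed.

End TC.

(** The cubic factor comes from [n] rounds over all pairs. The coefficient 5 counts array accesses:
    at most two per pair, one in the initialization loop, one to mark the start and one to read the
    answer. *)
Lemma spec_tc D n (e : rel 'I_n) f B x y : spec D e B f ->
  spec D e ((5 * ((120 + 60 * nreg D) * n.+1 ^ 2) + B + 100) * n.+1 ^ 3) (FTC x y f).
Proof.
move=> Hf d env m o /= led /and3P[ltx lty wff].
set W := (120 + 60 * nreg D) * n.+1 ^ 2; set Bb := W + (B + (W + 2) + 2).
apply: wp_le (_ : (1 + W + 20) * n.+1 + (1 + (1 + (W + (n * 9 + 2 +
   (n * (1 + ((Bb + 20) * n.+1 + 20) * n.+1 + 2) + 1 + W))))) <= _); last first.
  rewrite /Bb; clear Bb; clearbody W; rewrite (_ : n.+1 ^ 3 = n.+1 * n.+1 * n.+1); last by rewrite !expnS; lia.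
  by nia.
have ltd : d.+1 < D by lia.
have near0 t : near D n d m t m by [].
have [t0 t2 t4 t5 t6] := near_tmp o ltd (near0 0).
apply: wp_seq; apply: wp_mono (wp_tc_init o ltd) (leqnn _) _ => m1 _ [h3 hA hf].
have lo a : a < 7 -> a != 3 -> m1 a = m a by move=> lta a3; apply: hf => //; unregs; lia.
apply/wp_seq/wp_dec; apply/wp_seq/wp_inc => //.
have -> : upd (upd m1 3 (m1 3).-1) 3 (upd m1 3 (m1 3).-1 3).+1 = upd m1 3 1.
  by memext.
have mE x' : x' < d -> m1 (idx x') = env x'.
  by move=> ltx'; rewrite hf ?(ok_env o) //; unregs; lia.
have [u0 u2 u4 u5] : [/\ m1 0 = n, m1 2 = base D n, m1 4 = 0 & m1 5 = 0].
  by split; rewrite lo.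
apply: wp_seq; apply: (wp_arr_write (i := env x) (n := n)) => //; try lia.
  by rewrite updE mE.
set m2 := upd _ _ _.
have m2E a : a != 3 -> a < arr D n d 0 -> m2 a = m a.
  move=> a3 lta; rewrite /m2 !updE (negbTE a3) ifN_eq ?hf //.
  by rewrite neq_ltn (leq_trans lta) //; unregs; lia.
have lo2 a : a < 7 -> a != 3 -> m2 a = m a by move=> lta a3; apply: m2E => //; unregs; lia.
have mf : m (flg d) = 0 by rewrite (ok_free o) //; unregs; lia.
have m2f : m2 (flg d) = 0 by rewrite m2E //; unregs; lia.
have m20 : m2 0 = n by rewrite lo2.
apply: wp_seq; rewrite -{1}m20; apply: wp_addto => //; first by rewrite lo2.
rewrite m2f m20 add0n; apply: wp_seq.
apply: wp_mono (wp_tc_loop (x0 := env x) o ltd Hf led wff _) (leqnn _) _.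
  split.
  - by rewrite /m2; ups.
  - move=> i; rewrite inE updE ifN_eq; last by unregs; lia.
    rewrite /m2 !updE /arr eqn_add2l -(inj_eq val_inj); case: eqP => // _.
    by rewrite ifN_eq; [rewrite -/(arr D n d i) hA inE | unregs; lia].
  - by move=> a a3 lta; rewrite !updE; case: eqP => // _; rewrite m2E.
move=> m3 _ [k3 kA kf].
have lo3 a : a < 7 -> a != 3 -> m3 a = m a by move=> lta a3; apply: kf => //; unregs; lia.
have [v0 v2 v4 v5] : [/\ m3 0 = n, m3 2 = base D n, m3 4 = 0 & m3 5 = 0].
  by split; rewrite lo3.
apply: (wp_arr_read (i := env y) (n := n)) => //; try lia.
  by rewrite kf ?(ok_env o) //; unregs; lia.
split; first by rewrite updE eqxx kA inE.
by move=> a a3 lta; rewrite updE (negbTE a3) kf.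
Qed.

(** [C] depends on [D] and [f] but not on the graph; the 2 in the exponent is the cost of computing
    an address by counting. *)
Lemma compile_spec D f : exists C, forall n (e : rel 'I_n),
  spec D e (C * n.+1 ^ (2 + lev f)) f.
Proof.
have powm n a b : a <= b -> n.+1 ^ a <= n.+1 ^ b by move=> le; rewrite leq_pexp2l.
have spec_le n (e : rel 'I_n) g B B' : B <= B' -> spec D e B g -> spec D e B' g.
  by move=> le_B H d env m o led w; apply: wp_le (H d env m o led w) le_B.
elim: f => [|x y|f [C1 IH1] g [C2 IH2]|f [C IH]|f [C IH]|x y f [C IH]].
- exists 2 => n e; apply: (spec_le _ _ _ _ _ _ (@spec_true D n e)).
  by rewrite leq_pmulr // expn_gt0.
- by exists (120 + 60 * nreg D) => n e; apply: spec_edge.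
- exists (C1 + C2 + 2) => n e; apply: (spec_le _ _ _ _ _ _ (spec_and (IH1 n e) (IH2 n e))).
  set q := n.+1 ^ (2 + lev (FAnd f g)).
  have q0 : 0 < q by rewrite expn_gt0.
  have l1 : n.+1 ^ (2 + lev f) <= q by apply: powm => /=; lia.
  have l2 : n.+1 ^ (2 + lev g) <= q by apply: powm => /=; lia.
  by move: (leq_mul (leqnn C1) l1) (leq_mul (leqnn C2) l2); lia.
- exists (C + 3) => n e; apply: (spec_le _ _ _ _ _ _ (spec_not (IH n e))).
  have q0 : 0 < n.+1 ^ (2 + lev f) by rewrite expn_gt0.
  by rewrite /= mulnDl leq_add2l leq_pmulr.
- exists (C + 29) => n e; apply: (spec_le _ _ _ _ _ _ (spec_ex (IH n e))).
  rewrite /= (_ : n.+1 ^ (2 + (1 + lev f)) = n.+1 * n.+1 ^ (2 + lev f)); last first.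
    by rewrite addnCA add1n expnS.
  have q0 : 0 < n.+1 ^ (2 + lev f) by rewrite expn_gt0.
  have : n.+1 <= n.+1 * n.+1 ^ (2 + lev f) by rewrite leq_pmulr.
  by move: (n.+1 ^ (2 + lev f)) => q; lia.
- exists (5 * (120 + 60 * nreg D) + C + 100) => n e; apply: (spec_le _ _ _ _ _ _ (@spec_tc D n e f _ x y (IH n e))).
  rewrite /= addnCA [n.+1 ^ (3 + _)]expnD [n.+1 ^ 3 * _]mulnC mulnA.
  rewrite [X in _ <= X]mulnA leq_mul2r; apply/orP; right.
  have q0 : 0 < n.+1 ^ (2 + lev f) by rewrite expn_gt0.
  have l1 : n.+1 ^ 2 <= n.+1 ^ (2 + lev f) by apply: powm; lia.
  move: q0 l1; set q := n.+1 ^ (2 + _); set w := n.+1 ^ 2; set c := 120 + _ => q0 l1.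
  have := leq_mul (leqnn c) l1; lia.
Qed.

(** * Loading the input and deciding *)

Definition bit_write (c : nat) : lcmd :=
  addto 2 4 ;; rep c (Linc 4) ;; Linc 6 ;; Lsti 4 6 ;; Ldec 6 ;; zero 4.

Lemma wp_bit_write c b (Q : _ -> Prop) m : 7 <= b -> m 2 = b -> m 4 = 0 -> m 5 = 0 -> m 6 = 0 ->
  Q (upd m (b + c) 1) -> wp (bit_write c) (b * 12 + c * 4 + 6) Q m.
Proof.
move=> b7 m2 m4 m5 m6 Qm.
apply: wp_le (_ : b * 9 + 2 + (c + (1 + (1 + (1 + ((b + c) * 3 + 1))))) <= _); last by lia.
rewrite -{1}m2; apply/wp_seq/wp_addto => //; apply/wp_seq/wp_rep_inc => //.
set m1 := upd _ _ _; have -> : m1 = upd m 4 (b + c) by rewrite /m1; memext.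
apply/wp_seq/wp_inc => //; apply/wp_seq/wp_sti; first by rewrite /upd /=; lia.
apply/wp_seq/wp_dec.
have e4 : upd (upd m 4 (b + c)) 6 (upd m 4 (b + c) 6).+1 4 = b + c by [].
rewrite e4; apply: wp_le (wp_zero _) _; last by rewrite !updE /= ifN_eq //; lia.
match goal with |- Q ?mm => suff -> : mm = upd m (b + c) 1 by [] end.
by memext.
Qed.

Definition write_bits : seq nat -> lcmd := foldr (fun c => Lseq (bit_write c)) Lskip.

Lemma wp_write_bits r b bs m : 7 <= b -> m 2 = b -> m 4 = 0 -> m 5 = 0 -> m 6 = 0 ->
  (forall c, c \in bs -> c <= r) ->
  wp (write_bits bs) (size bs * (b * 12 + r * 4 + 6))
    (fun m' => forall a, m' a = if (b <= a) && (a - b \in bs) then 1 else m a) m.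
Proof.
move=> b7; elim: bs m => [|c bs IH] m m2 m4 m5 m6 Hr.
  by apply: wp_skip => a; rewrite in_nil andbF.
rewrite /= mulSn; apply: wp_seq; apply: wp_le (wp_bit_write (b := b) _ _ _ _ _ _) _ => //; last first.
  by have := Hr c (mem_head _ _); lia.
apply: wp_mono (IH _ _ _ _ _ _) (leqnn _) _; try by rewrite updE ifN_eq //; lia.
  by move=> c' c'bs; apply: Hr; rewrite inE c'bs orbT.
move=> m' _ H a; rewrite H inE updE; case: (a - b \in bs); rewrite ?orbT ?andbT ?andbF ?orbF.
  by case: leqP => // lt; rewrite ifN_eq //; lia.
have [->|ne] := eqVneq a (b + c); first by rewrite leq_addr addKn eqxx.
by rewrite ifN //; lia.
Qed.

Definition leaf (D : nat) (bs : seq nat) : lcmd :=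
  addto 0 6 ;; muladd 6 0 2 ;; rep (nreg D) (Linc 2) ;; write_bits bs.

(* Since the input occupies the registers, its first cells are read into the
   control state, one program branch per bit, before they can be reused. *)
Fixpoint load (D k c : nat) (bs : seq nat) : lcmd :=
  if k is k'.+1 then
    Lif c (Ldec c ;; load D k' c.+1 (c :: bs)) (load D k' c.+1 bs)
  else leaf D bs.

Section Load.
Variables (D n : nat) (inp : nat -> nat).
Hypothesis inp0 : inp 0 = n.
Hypothesis inp1 : inp 1 = 0.
Hypothesis inp_bit : forall a, 0 < a -> inp a <= 1.

Definition bits_below (c : nat) (bs : seq nat) : Prop :=
  forall a, (a \in bs) = (2 <= a < c) && (inp a == 1).

Definition cleared (c : nat) (m : nat -> nat) : Prop :=
  forall a, m a = if 2 <= a < c then 0 else inp a.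

(** Only bits equal to 1 are copied behind [base]. A 0 needs no copy, because the cells beyond the
    input are already 0. *)
Definition loaded (m : nat -> nat) : Prop := [/\ m 0 = n, m 2 = base D n,
  forall a, 3 <= a < nreg D -> m a = 0 &
  forall a, nreg D <= a -> m a =
    if [&& base D n <= a, 2 <= a - base D n < nreg D & inp (a - base D n) == 1] then 1 else inp a].

Let leaf_cost := n * 9 + 2 + (n * (n * 9 + 5) + 1 +
  (nreg D + nreg D * (base D n * 12 + nreg D * 4 + 6))).

Lemma wp_leaf bs m : bits_below (nreg D) bs -> size bs <= nreg D -> cleared (nreg D) m ->
  wp (leaf D bs) leaf_cost loaded m.
Proof.
move=> Hbs szbs Hm.
have r7 : 7 <= nreg D by rewrite /nreg; lia.
have m0 : m 0 = n by rewrite Hm.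
have mr a : 2 <= a < nreg D -> m a = 0 by rewrite Hm => ->.
have z2 : m 2 = 0 by apply: mr; lia.
have z4 : m 4 = 0 by apply: mr; lia.
have z5 : m 5 = 0 by apply: mr; lia.
have z6 : m 6 = 0 by apply: mr; lia.
rewrite /leaf_cost -{1}m0; apply/wp_seq/wp_addto => //.
set m1 := upd _ _ _.
have m10 : m1 0 = n by [].
have m16 : m1 6 = n by rewrite /m1 /upd /=; lia.
rewrite -{1}m16 -{1}[in m1 6 * (n * 9 + 5)]m10; apply/wp_seq/wp_muladd => //.
apply/wp_seq/wp_rep_inc => //.
set m2 := upd _ _ _.
have -> : m2 = upd m 2 (base D n).
  by rewrite /m2 m10 m16 /m1 /base; memext.
apply: wp_mono (wp_write_bits (r := nreg D) (b := base D n) _ _ _ _ _ _) _ _ => //.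
- by rewrite /base; lia.
- by move=> c; rewrite Hbs; lia.
- by rewrite leq_mul2r szbs orbT.
have ltb : nreg D <= base D n by rewrite /base; lia.
move=> m' _ H; split.
- by rewrite H ifN; [|lia].
- by rewrite H ifN; [|lia].
- move=> a Ha; rewrite H ifN; last by lia.
  by rewrite updE ifN_eq ?mr //; lia.
- move=> a Ha; rewrite H Hbs andbA; case: ifP => // _.
  by rewrite updE ifN_eq ?Hm ?ifN //; lia.
Qed.

Lemma wp_load k c bs m : k + c = nreg D -> 2 <= c -> bits_below c bs -> size bs <= c ->
  cleared c m -> wp (load D k c bs) (k * 3 + leaf_cost) loaded m.
Proof.
elim: k c bs m => [|k IH] c bs m kc c2 Hbs szbs Hm.
  by rewrite add0n in kc; subst c; apply: wp_leaf.
have mc : m c = inp c by rewrite Hm ltnn andbF.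
have bc := inp_bit (ltnW c2).
apply: wp_le (_ : 1 + (k * 3 + leaf_cost) + 2 <= _); last by rewrite mulSn; lia.
apply: wp_if; rewrite mc => Hc.
  have c1 : inp c = 1 by lia.
  apply/wp_seq/wp_dec; apply: IH => //; [lia | lia | |].
    move=> a; rewrite inE Hbs; case: eqVneq => [->|ne]; first by rewrite c1 eqxx andbT; lia.
    by rewrite /=; congr (_ && _); lia.
  move=> a; rewrite updE mc c1 Hm; case: eqVneq => [->|ne]; first by rewrite ifT //; lia.
  by congr (if _ then _ else _); lia.
apply: wp_le (_ : k * 3 + leaf_cost <= _); last by rewrite leq_addl.
apply: IH => //; [lia | lia | | lia |].
  move=> a; rewrite Hbs; case: (eqVneq a c) => [->|ne]; first by rewrite Hc !andbF.
  by congr (_ && _); lia.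
move=> a; rewrite Hm; case: (eqVneq a c) => [->|ne]; first by rewrite Hc !if_same.
by congr (if _ then _ else _); lia.
Qed.

Lemma wp_load0 : wp (load D (nreg D - 2) 2 [::]) (200 * nreg D * nreg D * n.+1 ^ 2) loaded inp.
Proof.
apply: wp_le (wp_load _ _ _ _ _) _ => //.
- by rewrite subnK // /nreg; lia.
- by move=> a; rewrite in_nil; lia.
- by move=> a; rewrite ifN //; lia.
rewrite /leaf_cost /base; have : 7 <= nreg D by rewrite /nreg; lia.
move: (nreg D) => r r7; rewrite (_ : n.+1 ^ 2 = n * n + 2 * n + 1); last by rewrite expnS expn1; lia.
have rr0 : 0 < r * r by rewrite muln_gt0; lia.
have : n <= r * r * n by rewrite leq_pmull.
have : n * n <= r * r * (n * n) by rewrite leq_pmull.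
have : r * (n * n) <= r * r * (n * n) by rewrite leq_mul2r leq_pmull ?orbT //; lia.
have : r <= r * r by rewrite leq_pmull //; lia.
by lia.
Qed.
End Load.

(** Distinct pairs have distinct addresses: row and column are the quotient and the remainder of the
    address minus 1 by [n]. *)
Lemma enc_graphE n (e : rel 'I_n) (i j : 'I_n) : enc_graph e (1 + i * n + j) = e i j.
Proof.
rewrite /enc_graph; congr nat_of_bool; apply/existsP/idP => [[i' /existsP[j' /andP[/eqP E]]]|eij].
  have hj := ltn_ord j; have hj' := ltn_ord j'.
  have n0 : 0 < n by apply: leq_ltn_trans hj.
  have E' : i * n + j = i' * n + j' by lia.
  have Ei : i = i'.
    by apply: val_inj; have := congr1 (divn^~ n) E'; rewrite !divnMDl // !divn_small // !addn0.
  have Ej : j = j'.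
    by apply: val_inj; have := congr1 (modn^~ n) E'; rewrite !modnMDl !modn_small.
  by rewrite Ei Ej.
by exists i; apply/existsP; exists j; rewrite eqxx.
Qed.

Lemma enc_graph_bit n (e : rel 'I_n) a : 0 < a -> enc_graph e a <= 1.
Proof. by rewrite /enc_graph; case: a => //= a _; case: [exists _, _]. Qed.

Lemma enc_graph_out n (e : rel 'I_n) a : n * n < a -> enc_graph e a = 0.
Proof.
rewrite /enc_graph; case: a => // a lta /=; case: existsP => // -[i /existsP[j /andP[/eqP E _]]].
by have := ltn_ord i; have := ltn_ord j; nia.
Qed.

(** Cell 1 encodes a loop at vertex 0, which an acyclic graph lacks. This supplies the zero in
    register 1 that compiled code expects at its start. *)
Lemma enc_graph1 n (e : rel 'I_n) : acyclic e -> enc_graph e 1 = 0.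
Proof.
move=> ac; rewrite /enc_graph /=; case: existsP => // -[i /existsP[j /andP[/eqP E eij]]].
have hn : 0 < n by apply: leq_ltn_trans (ltn_ord i).
have Eij : i = j by apply: val_inj => /=; nia.
by move: (ac _ _ eij); rewrite Eij connect0.
Qed.

Lemma loaded_ok D n (e : rel 'I_n) env m : acyclic e -> loaded D n (enc_graph e) m ->
  m 1 = 0 -> ok D e 0 env m.
Proof.
move=> ac [m0 m2 mr mi] m1.
have r7 : 7 <= nreg D by rewrite /nreg; lia.
split=> //.
- by rewrite mr //; lia.
- by move=> a Ha; apply: mr; lia.
- by move=> a Ha; apply: mr; move: Ha; unregs; lia.
move=> i j /=; set p := 1 + _ + _.
have lep : 0 < p <= n * n by have := ltn_ord i; have := ltn_ord j; rewrite /p; nia.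
rewrite -(enc_graphE e i j) -/p; case: ifP => Hp.
  by rewrite mi // ifN // /base; lia.
rewrite mi; last by rewrite /base; lia.
have {}Hp : p < nreg D by rewrite ltnNge Hp.
(* The cell [base D n + p] lies beyond the encoding, so unless a 1 was copied there it reads 0. *)
rewrite leq_addr addKn Hp andbT /= (@enc_graph_out _ _ (base D n + p)); last by rewrite /base; lia.
(* Loading starts at cell 2; cell 1 needs no copy, as it is 0 by acyclicity. *)
have [->|p1] := eqVneq p 1; first by rewrite enc_graph1.
rewrite (_ : 1 < p); last by lia.
have : enc_graph e p <= 1 by apply: enc_graph_bit; lia.
by case: (enc_graph e p) => [|[]].
Qed.

(** * The decision program and its running time *)

Definition dtd_prog (k : nat) : lcmd :=
  let f := dtF k setT_form 0 in
  let D := lev f in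
  Lif 0 (load D (nreg D - 2) 2 [::] ;; compile D 0 f ;; zero 0 ;; Lif 3 (Linc 0) Lskip)
    (Linc 0).

Lemma dtd_le0 (e : rel 'I_0) k : dtd_le e k.
Proof.
exists [::]; split=> //; rewrite (_ : [set: _] = set0); first by constructor.
by apply/setP => -[].
Qed.

Lemma wp_dtd_prog k : exists C, forall n (e : rel 'I_n), acyclic e ->
  wp (dtd_prog k) (C * n.+1 ^ (8 * k + 3))
    (fun m => m 0 <= 1 /\ (m 0 = 1 <-> dtd_le e k)) (enc_graph e).
Proof.
set f := dtF k setT_form 0; set D := lev f.
have [|wff levf] := @good_dtF k setT_form 0 0; first by [].
rewrite -/f -/D addn0 in wff levf.
have [C HC] := compile_spec D f.
exists (200 * nreg D * nreg D + C + 10) => n e ac.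
(* [levf] bounds the nesting weight by 8k + 1, and address computations add 2. *)
set q := n.+1 ^ (8 * k + 3).
have q2 : n.+1 ^ 2 <= q by rewrite leq_pexp2l //; lia.
have qf : n.+1 ^ (2 + lev f) <= q by rewrite leq_pexp2l //; lia.
have q1 : n.+1 <= q by apply: leq_trans q2; rewrite expnS expn1; lia.
apply: wp_le (_ : 200 * nreg D * nreg D * n.+1 ^ 2 + (C * n.+1 ^ (2 + lev f) +
    (n * 3 + 1 + (1 + 2))) + 2 <= _); last first.
  move: (leq_mul (leqnn (200 * nreg D * nreg D)) q2) (leq_mul (leqnn C) qf).
  by rewrite !mulnDl; lia.
(* Without vertices there is no environment to evaluate in. The answer is then positive, and
   incrementing register 0, which holds n = 0, outputs it. *)
apply: wp_if => [n0|n0]; last first.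
  have En : n = 0 := n0; subst n.
  apply: wp_le (_ : 1 <= _); last by lia.
  by apply: wp_inc => //; split=> //; split=> // _; apply: dtd_le0.
have n_gt0 : 0 < n by rewrite lt0n; exact: n0.
(* The formula is closed, so an arbitrary vertex may fill the environment. *)
pose env (x : nat) := Ordinal n_gt0.
apply: wp_seq.
apply: wp_mono (wp_load0 D (n := n) _ (enc_graph1 ac) (@enc_graph_bit n e)) (leqnn _) _ => //.
move=> m1 m11 ld; have o1 : ok D e 0 env m1 by apply: loaded_ok.
apply: wp_seq; apply: wp_mono (HC n e 0 env m1 o1 (leqnn _) wff) (leqnn _) _.
move=> m2 _ [r2 f2].
have m20 : m2 0 = n by rewrite f2 ?(ok_n o1) //; unregs; lia.
apply/wp_seq; apply: wp_le (wp_zero _) _; last by rewrite m20.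
have dP := dtP [set: 'I_n] k ac.
rewrite /f eval_dtd in r2.
have m3 : upd m2 0 0 3 = dt e k [set: 'I_n] by rewrite updE.
apply: wp_if; rewrite m3 => H.
  apply: wp_inc => //; split=> //; split=> // _.
  by apply/dP; case: dt H.
apply: wp_le (wp_skip _) (leq0n _); split=> //; split=> //.
by case: dP H.
Qed.

(** A compiled fragment contains no [HALT]; it stops by running off its end, where [nth] returns the
    default [HALT]. *)
Lemma wp_program c T Q m : m 1 = 0 -> wp c T Q m -> exists t m',
  [/\ t <= T, Q m', halted (gen 0 c) (exec (gen 0 c) t (Config 0 m)) &
      Defs.mem (exec (gen 0 c) t (Config 0 m)) = m'].
Proof.
move=> m1 /(_ m1) [t [m' [le_t _ Qm E]]]; exists t, m'.
have {}E := E (gen 0 c) 0 (fun i _ => erefl).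
by rewrite E; split=> //; rewrite /halted /= add0n nth_default // size_gen.
Qed.

Lemma ram_computable_affine a b : ram_computable (fun k => a * k + b).
Proof.
exists (gen 0 (rep a (addto 0 2) ;; rep b (Linc 2) ;; zero 0 ;; addto 2 0)) => x.
set m : nat -> nat := fun i => if i == 0 then x else 0.
set T := a * (x * 9 + 2) + (b + (x * 3 + 1 + ((a * x + b) * 9 + 2))).
have [|t [m' [le_t Qm Hh Em]]] := @wp_program (rep a (addto 0 2) ;; rep b (Linc 2) ;; zero 0 ;; addto 2 0) T
  (fun m' => m' 0 = a * x + b) m erefl.
  apply: wp_seq.
  apply: wp_mono (wp_rep (I := fun i m' => m' = upd m 2 (i * x)) _ _) (leqnn _) _.
  - move=> i m1 _ ->; rewrite -[x in x * 9](_ : upd m 2 (i * x) 0 = x) //.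
    by apply: wp_addto => //; rewrite /upd /m /=; apply: functional_extensionality => y; case: eqP => // _; lia.
  - by rewrite mul0n /m; memext.
  move=> m1 _ ->; apply/wp_seq/wp_rep_inc => //.
  apply: wp_seq; rewrite -[x in x * 3](_ : upd (upd m 2 (a * x)) 2 (upd m 2 (a * x) 2 + b) 0 = x) //.
  apply: wp_zero; set m2 := upd _ _ _.
  have m22 : m2 2 = a * x + b by [].
  by rewrite -m22; apply: wp_addto.
by exists T, t; split=> //; split=> //; rewrite Em.
Qed.

Theorem mainTheorem4 :
  exists f : nat -> nat, ram_computable f /\
  forall k : nat, exists (P : seq instr) (C : nat),
    forall (n : nat) (e : rel 'I_n), acyclic e ->
      decides_within P (enc_graph e) (C * n ^ f k + C) (dtd_le e k).
Proof.
exists (fun k => 8 * k + 3); split; first exact: ram_computable_affine.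
move=> k; have [C HC] := wp_dtd_prog k.
(* The factor [2 ^ (8 * k + 3)] absorbs n + 1 <= 2n for positive n; the additive constant covers n =
   0. *)
exists (gen 0 (dtd_prog k)), (C * 2 ^ (8 * k + 3)) => n e ac.
have [t [m [le_t [out01 outP] Hh Em]]] := wp_program (enc_graph1 ac) (HC n e ac).
exists (m 0); split=> //; exists t; split; last by rewrite Em.
apply: leq_trans le_t _; case: n {e ac HC out01 outP Hh Em m t} => [|n].
  by rewrite exp1n muln1 (leq_trans _ (leq_addl _ _)) // leq_pmulr // expn_gt0.
rewrite -mulnA -expnMn (leq_trans _ (leq_addr _ _)) // leq_mul2l leq_exp2r ?orbT //; last by lia.
by apply/orP; right; lia.
Qed.
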